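(* Let $F$ be an admissible finite set of positive integers. Then the polynomials $H_n^F$, $n\in\sigma_F$, are orthogonal with respect to the positive weight $$\omega_F(x)=\frac{e^{-x^2}}{\Omega_F^2(x)},\qquad x\in\mathbb{R},$$ and their linear combinations are dense in $L^2(\omega_F)$. Hence $H_n^F$, $n\in\sigma_F$, are exceptional Hermite polynomials, that is, they are orthogonal and complete with respect to a positive measure.
   Context: Hermite polynomials: $H_n(x)=n!\sum_{j=0}^{[n/2]}\frac{(-1)^j(2x)^{n-2j}}{j!(n-2j)!}$. For $F=\{f_1<\cdots<f_k\}$ put $u_F=\sum_{f\in F}f-\binom{k+1}{2}$ and $\sigma_F=\{u_F,u_F+1,u_F+2,\dots\}\setminus\{u_F+f: f\in F\}$. For $n\in\sigma_F$, $H_n^F(x)$ is the $(k+1)\times(k+1)$ determinant whose first row is $(H_{n-u_F}^{(j)}(x))_{j=0}^k$ and whose $(i+1)$-th row is $(H_{f_i}^{(j)}(x))_{j=0}^k$, $i=1,\dots,k$. Also $\Omega_F(x)=\det\big(H_{f_i}^{(j-1)}(x)\big)_{i,j=1}^k$. Admissible: write $F=\bigcup_{i=1}^KY_i$ as a disjoint union where the elements of each $Y_i$ are consecutive integers and $1+\max Y_i<\min Y_{i+1}$ for $i=1,\dots,K-1$. $F$ is admissible if every $Y_i$ has an even number of elements. (For $F$ admissible, $\Omega_F$ has no real zeros, so $\omega_F$ is well defined.) *)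

(* Defs.v *)
From HB Require Import structures.
From mathcomp Require Import all_boot all_order all_algebra finmap.
From mathcomp Require Import all_classical all_reals all_analysis measurable_realfun.

Set Implicit Arguments.
Unset Strict Implicit.
Unset Printing Implicit Defensive.

Import Order.TTheory GRing.Theory Num.Theory.
Import numFieldNormedType.Exports.

Local Open Scope ring_scope.

(* The elements f_1 < ... < f_k of F; f_i is the entry of index i - 1. *)
Definition felems (F : {fset nat}) : seq nat := sort leq (enum_fset F).

Definition fmin (Y : {fset nat}) : nat := head 0%N (felems Y).
Definition fmax (Y : {fset nat}) : nat := last 0%N (felems Y).

Definition consecutive (Y : {fset nat}) : Prop :=
  exists a l : nat, Y = [fset i | i in iota a l.+1]%fset.

(* The blocks are Y 0, ..., Y K.-1; the values of Y from K on are irrelevant.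
   Each block is nonempty, and such a decomposition of F is unique. *)
Definition block_decomposition (F : {fset nat}) (K : nat)
    (Y : nat -> {fset nat}) : Prop :=
  [/\ F = \big[fsetU/fset0]_(i < K) Y i,
      forall i j, (i < j < K)%N -> [disjoint Y i & Y j]%fset,
      forall i, (i < K)%N -> consecutive (Y i)
    & forall i, (i.+1 < K)%N -> ((fmax (Y i)).+1 < fmin (Y i.+1))%N].

Definition admissible (F : {fset nat}) : Prop :=
  exists (K : nat) (Y : nat -> {fset nat}),
    block_decomposition F K Y /\
    forall i, (i < K)%N -> ~~ odd #|` Y i|.

(* The subtraction does not truncate when the elements of F are positive. *)
Definition uF (F : {fset nat}) : nat :=
  (\sum_(f <- felems F) f - 'C(#|` F|.+1, 2))%N.

Definition sigmaF (F : {fset nat}) : pred nat :=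
  [pred n | (uF F <= n)%N & n \notin [seq (uF F + f)%N | f <- felems F]].

Section Hermite.
Variable R : realType.

Definition hermite (n : nat) : {poly R} :=
  n`!%:R *: \sum_(j < n./2.+1)
    ((-1) ^+ j / (j`! * (n - j.*2)`!)%:R) *: (2 *: 'X) ^+ (n - j.*2).

Definition hermiteF (F : {fset nat}) (n : nat) : {poly R} :=
  \det (\matrix_(i < #|` F|.+1, j < #|` F|.+1)
    (hermite (nth 0%N ((n - uF F)%N :: felems F) i))^`(j)).

Definition OmegaF (F : {fset nat}) : {poly R} :=
  \det (\matrix_(i < #|` F|, j < #|` F|)
    (hermite (nth 0%N (felems F) i))^`(j)).

Definition omegaF (F : {fset nat}) (x : R) : R :=
  expR (- x ^+ 2) / (OmegaF F).[x] ^+ 2.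

End Hermite.

Section WeightMeasure.
Variable R : realType.
Implicit Types F : {fset nat}.

Definition omega_measure F (A : set (measurableTypeR R)) : \bar R :=
  (\int[lebesgue_measure]_(x in A) (omegaF F x)%:E)%E.

Lemma omegaF_ge0 F (x : R) : 0 <= omegaF F x.
Proof. by rewrite divr_ge0 ?expR_ge0 ?sqr_ge0. Qed.

Lemma measurable_omegaF F :
  measurable_fun [set: measurableTypeR R] (@omegaF R F).
Proof.
have mp (p : {poly R}) : measurable_fun [set: measurableTypeR R] (horner p).
  by apply: continuous_measurable_fun; exact: continuous_horner.
have -> : @omegaF R F =
    (fun x => expR (- ('X ^+ 2).[x]) * ((OmegaF R F ^+ 2).[x] `^ (-1))).
  by apply/funext => x; rewrite !hornerE powR_inv1 ?sqr_ge0.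
apply: measurable_funM.
  apply: measurableT_comp; first exact: measurable_expR.
  exact: measurable_funN.
by apply: (measurableT_comp (f := fun y : R => y `^ (-1)));
  [exact: measurable_powR|exact: mp].
Qed.

Let omega0 F : omega_measure F set0 = 0%E.
Proof. exact: integral_set0. Qed.

Let omega_ge0 F A : (0 <= omega_measure F A)%E.
Proof. by apply: integral_ge0 => x _; rewrite lee_fin omegaF_ge0. Qed.

Let omega_sigma_additive F : semi_sigma_additive (omega_measure F).
Proof.
move=> /= A mA tA mUA; rewrite /omega_measure ge0_integral_bigcup//=.
- apply: is_cvg_ereal_nneg_natsum_cond => n _ _.
  by apply: integral_ge0 => x _; rewrite lee_fin omegaF_ge0.
- apply: measurable_funTS; apply/measurable_EFinP; exact: measurable_omegaF.
- by move=> x _; rewrite lee_fin omegaF_ge0.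
Qed.

HB.instance Definition _ F := isMeasure.Build _ _ _ (omega_measure F)
  (omega0 F) (omega_ge0 F) (@omega_sigma_additive F).

End WeightMeasure.

Section Exceptional.
Variables (R : realType).
Implicit Types (mu : {measure set (measurableTypeR R) -> \bar R})
  (I : pred nat) (p : nat -> {poly R}).

(* Square integrability makes the integrals of products finite; as usual for
   orthogonal polynomials, the norms are required not to vanish. *)
Definition orthogonal_wrt mu I p : Prop :=
  [/\ forall n, I n -> horner (p n) \in Lfun mu 2%:E,
      forall n m, I n -> I m -> n <> m ->
        (\int[mu]_x ((p n).[x] * (p m).[x])%:E = 0)%E
    & forall n, I n -> (\int[mu]_x ((p n).[x] ^+ 2)%:E != 0)%E].

Definition complete_wrt mu I p : Prop :=
  forall f : R -> R, f \in Lfun mu 2%:E -> forall e : R, 0 < e ->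
  exists (s : seq nat) (c : nat -> R), all I s /\
    (Lnorm mu 2%:E (fun x => (f x - (\sum_(n <- s) c n *: p n).[x])%:E)
      < e%:E)%E.

Definition orthogonal_complete I p : Prop :=
  exists mu, orthogonal_wrt mu I p /\ complete_wrt mu I p.

End Exceptional.

(* Main.v *)
Require Import Defs.
From mathcomp Require Import all_boot all_order all_algebra finmap.
From mathcomp Require Import all_classical all_reals all_analysis measurable_realfun.
From mathcomp Require Import ring lra zify.

(** Let [w = exp (-x^2)], [A p = X p' - p''/2] (so [A H_n = n H_n]) and
    [P(n) = prod_(f in F) (n - f)], which is nonnegative on [nat] because [F]
    is admissible.

    No zeros: if [Omega_F(x0) = 0], some nonzero combination [g] of the [H_f]
    vanishes at [x0] to the order [k = #|F|].  The truncation [S] of [g] to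
    [[x0, +oo[] is then smooth enough for integration by parts without boundary
    terms, and, writing [P = P1 P2] with factors of degree [k/2],
    [sum_n P(n) <S, H_n>^2 / |H_n|^2 = <P1(A) S, P2(A) S> = <S, P(A) S> = 0].
    Hence [S] is orthogonal to [H_n] for all [n] outside [F], so it is a
    polynomial, so [g = 0].

    Orthogonality: let [g_p(.; x)] be the [p - sum_i c_i(x) H_(f_i)] that
    vanishes at [x] to the order [k]; then the derivative in [x] of
    [int_x^oo g_p(t; x) H_n(t) w(t) dt] is, up to sign,
    [W(H_F, p) W(H_F, H_n) w / (2^k P(n) Omega_F^2)], which gives
    [<H_m^F, H_n^F> = 2^k P(n) <H_m, H_n>].  For [p = H_m] this is an algebraic
    identity, since the half-line integral of [H_f H_n w] has a closed form
    when [f <> n].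

    Completeness: by variation of parameters the span of the [H_n^F] contains
    [Omega_F^2 q] for every polynomial [q], and polynomials are dense in
    [L^2(Omega_F^2 w)]. *)

Set Implicit Arguments.
Unset Strict Implicit.
Unset Printing Implicit Defensive.

Import Order.TTheory GRing.Theory Num.Theory.
Import numFieldNormedType.Exports.

Local Open Scope ring_scope.

(** * The Hermite operator *)

Section HermiteOperator.
Variable R : realType.
Implicit Types (p q u v : {poly R}) (x : R) (s : seq nat).

Definition hop p : {poly R} := 'X * p^`() - 2^-1 *: p^`()^`().

Lemma hopD p q : hop (p + q) = hop p + hop q.
Proof. by rewrite /hop !derivD mulrDr scalerDr opprD addrACA. Qed.

Lemma hopZ (c : R) p : hop (c *: p) = c *: hop p.
Proof.
by rewrite /hop !derivZ -scalerAr scalerBr !scalerA [2^-1 * c]mulrC.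
Qed.

Lemma hop_sum I (r : seq I) (P : pred I) (G : I -> {poly R}) :
  hop (\sum_(i <- r | P i) G i) = \sum_(i <- r | P i) hop (G i).
Proof.
apply: (big_morph _ hopD).
by rewrite /hop !deriv0 mulr0 scaler0 subr0.
Qed.

Lemma hopXn n :
  hop ('X^n : {poly R}) = n%:R *: 'X^n - (2^-1 * (n * n.-1)%:R) *: 'X^(n.-2).
Proof.
rewrite /hop derivXn derivMn derivXn -mulrnA mulrnAr -!['X^_ *+ _]scaler_nat.
rewrite scalerA [(_ * n)%N]mulnC.
by case: n => [|n]; rewrite -?exprS scaler_nat.
Qed.

(** [hop] sends the term of degree [n - 2j] to [n] times itself plus [D j.+1 - D j]: the factor
    [n - 2j] falls short of [n] by [2j], and the second derivative feeds the next term. The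
    differences telescope to zero. *)
Lemma hermite_eigen n : hop (hermite R n) = n%:R *: hermite R n.
Proof.
rewrite /hermite hopZ scalerA mulrC -scalerA; congr (_ *: _).
under eq_bigr do rewrite exprZn scalerA.
set S : {poly R} := \sum_(j < _) _.
pose c := fun j : nat =>
  (-1) ^+ j / (j`! * (n - j.*2)`!)%:R * 2 ^+ (n - j.*2) : R.
have -> : S = \sum_(j < n./2.+1) c j *: 'X^(n - j.*2) by [].
have cS j : (j.+1.*2 <= n)%N ->
    2^-1 * ((n - j.*2) * (n - j.*2).-1)%:R * c j = - (j.+1.*2)%:R * c j.+1.
  move=> jn; rewrite /c.
  have -> : (n - j.+1.*2 = (n - j.*2).-2)%N by lia.
  have : (1 < n - j.*2)%N by lia.
  case: (n - j.*2)%N => [|[|m]]//= _.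
  rewrite !factS !natrM !exprS -!mul2n natrM.
  have hj := fact_gt0 j; have hm := fact_gt0 m.
  by field; rewrite -!(natrD _ 1) -(natrD _ 2) !pnatr_eq0 -!lt0n hj hm.
clearbody c.
(* The guard makes [D] vanish one step past the last term, where truncated subtraction would leave a
   multiple of ['X^0]. *)
pose D j := if (j.*2 <= n)%N then ((j.*2)%:R * c j) *: ('X^(n - j.*2) : {poly
  R}) else 0.
have key j : (j.*2 <= n)%N ->
    hop (c j *: 'X^(n - j.*2)) = n%:R *: (c j *: 'X^(n - j.*2)) + (D j.+1 - D j).
  move=> jn; rewrite hopZ hopXn scalerBr !scalerA /D jn.
  have -> : n%:R = (n - j.*2)%:R + (j.*2)%:R :> R by rewrite -natrD subnK.
  rewrite mulrDl [in RHS]scalerDl [c j * (n - j.*2)%:R]mulrC -addrA; congr (_ + _).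
  rewrite addrCA subrr addr0.
  case: ifPn => [jn2|jn2].
    have -> : (n - j.+1.*2 = (n - j.*2).-2)%N by lia.
    by rewrite mulrC cS// -scaleNr mulNr opprK.
  have /orP[/eqP->|/eqP->] : ((n - j.*2 == 0) || (n - j.*2 == 1))%N by lia.
    by rewrite mul0n !mulr0 scale0r oppr0.
  by rewrite muln0 !mulr0 scale0r oppr0.
rewrite hop_sum; under eq_bigr => j _.
  rewrite key; last by move: (ltn_ord j) (odd_double_half n); lia.
  over.
rewrite big_split /= -scaler_sumr -[RHS]addr0; congr (_ + _).
rewrite -(big_mkord xpredT (fun j => D j.+1 - D j)) telescope_sumr// /D.
by rewrite mul0r scale0r subr0 ifF//; lia.
Qed.

Lemma size_hermite n : size (hermite R n) = n.+1.
Proof.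
rewrite /hermite size_scale ?pnatr_eq0 -?lt0n ?fact_gt0//.
rewrite big_ord_recl /= subn0 mul1n size_polyDl ?exprZn.
  by rewrite !size_scale ?size_polyXn// ?expf_neq0 ?pnatr_eq0//
    expr0 div1r invr_eq0 pnatr_eq0 -lt0n fact_gt0.
rewrite !scalerA size_scale ?size_polyXn; last first.
  by rewrite mulf_neq0 ?expf_neq0 ?pnatr_eq0// expr0 div1r invr_eq0 pnatr_eq0
    -lt0n fact_gt0.
rewrite ltnS; apply: (leq_trans (size_sum _ _ _)); apply/bigmax_leqP => j _.
rewrite exprZn scalerA (leq_trans (size_scale_leq _ _))// size_polyXn.
by rewrite /bump /=; move: (ltn_ord j); case: j => /= j; lia.
Qed.

(** Each [hermite R n] has degree exactly [n], so a suitable multiple of the top one removes the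
    leading term and the size drops. *)
Lemma hermite_span p :
  exists a : nat -> R, p = \sum_(n < size p) a n *: hermite R n.
Proof.
have [m] := ubnP (size p); elim: m p => // m IH p; rewrite ltnS => pm.
have [->|p0] := eqVneq p 0; first by exists (fun=> 0); rewrite size_poly0 big_ord0.
pose c := lead_coef p / lead_coef (hermite R (size p).-1).
have sp : (0 < size p)%N by rewrite size_poly_gt0.
have hp : (size p).-1.+1 = size p by rewrite prednK.
have c0 : c != 0.
  by rewrite mulf_neq0 ?invr_eq0 ?lead_coef_eq0// -size_poly_eq0 size_hermite.
pose q := p - c *: hermite R (size p).-1.
have sq : (size q < size p)%N.
  rewrite -[X in (_ < X)%N]hp ltnS; apply/leq_sizeP => i hi; rewrite coefB coefZ.
  move: hi; rewrite leq_eqVlt => /predU1P[<-|hi]; last first.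
    by rewrite !nth_default ?mulr0 ?subr0// ?size_hermite// -hp.
  rewrite -[p`_(size p).-1]lead_coefE /c.
  rewrite /lead_coef size_hermite /= divfK ?subrr//.
  by have := lead_coef_eq0 (hermite R (size p).-1);
    rewrite lead_coefE size_hermite => ->; rewrite -size_poly_eq0 size_hermite.
have [a qE] := IH q (leq_trans sq pm).
exists (fun n => (if (n < size q)%N then a n else 0) +
  (if n == (size p).-1 then c else 0)).
under eq_bigr do rewrite scalerDl.
transitivity (q + c *: hermite R (size p).-1); first by rewrite /q subrK.
rewrite big_split /=; congr (_ + _).
  rewrite {1}qE (big_ord_widen (size p) (fun n => a n *: hermite R n)) 1?ltnW//.
  rewrite big_mkcond.
  by apply: eq_bigr => i _; case: ifP => // _; rewrite scale0r.
rewrite -(big_mkord xpredT (fun n => (if n == (size p).-1 then c else 0) *: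
  hermite R n)).
rewrite -hp big_nat_recr//= eqxx big_nat big1 ?add0r// => i /andP[_ hi].
by rewrite ltn_eqF// scale0r.
Qed.

Definition hshift (f : nat) p : {poly R} := hop p - f%:R *: p.

(** A list of commuting factors rather than a polynomial in [hop], so that only part of them can be
    moved across an integral. *)
Definition hops s p : {poly R} := foldr hshift p s.

Lemma hshiftD f p q : hshift f (p + q) = hshift f p + hshift f q.
Proof. by rewrite /hshift hopD scalerDr opprD addrACA. Qed.

Lemma hshiftZ f (c : R) p : hshift f (c *: p) = c *: hshift f p.
Proof.
by rewrite /hshift hopZ [RHS]scalerBr ![_ *: (_ *: p)]scalerA [c * _]mulrC.
Qed.

Lemma hshiftC f1 f2 p : hshift f1 (hshift f2 p) = hshift f2 (hshift f1 p).
Proof.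
have E (c : R) q r : hop (q - c *: r) = hop q - c *: hop r.
  by rewrite -scaleNr hopD hopZ scaleNr.
by rewrite /hshift !E -!mul_polyC; ring.
Qed.

Lemma hopsD s p q : hops s (p + q) = hops s p + hops s q.
Proof. by elim: s => //= f s ->; rewrite hshiftD. Qed.

Lemma hopsZ s (c : R) p : hops s (c *: p) = c *: hops s p.
Proof. by elim: s => //= f s ->; rewrite hshiftZ. Qed.

Lemma hops0 s : hops s 0 = 0.
Proof. by rewrite -[X in hops s X](scale0r 0) hopsZ scale0r. Qed.

Lemma hops_sum s I (r : seq I) (P : pred I) (G : I -> {poly R}) :
  hops s (\sum_(i <- r | P i) G i) = \sum_(i <- r | P i) hops s (G i).
Proof. by apply: (big_morph _ (hopsD s)); exact: hops0. Qed.

Lemma hops_cat s1 s2 p : hops (s1 ++ s2) p = hops s1 (hops s2 p).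
Proof. by rewrite /hops foldr_cat. Qed.

Lemma hops_hshift s f p : hops s (hshift f p) = hshift f (hops s p).
Proof. by elim: s => //= g s ->; rewrite hshiftC. Qed.

Lemma hopsC s1 s2 p : hops s1 (hops s2 p) = hops s2 (hops s1 p).
Proof. by elim: s1 => //= f s1 ->; rewrite hops_hshift. Qed.

Lemma hops_hermite s n :
  hops s (hermite R n) = (\prod_(f <- s) (n%:R - f%:R)) *: hermite R n.
Proof.
elim: s => [|f s IH] /=; first by rewrite big_nil scale1r.
rewrite IH hshiftZ big_cons /hshift hermite_eigen -scalerBl scalerA.
by rewrite mulrC.
Qed.

Lemma hops_hermite0 s n : n \in s -> hops s (hermite R n) = 0.
Proof.
move=> ns; rewrite hops_hermite (big_rem n)//= subrr mul0r scale0r //.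
Qed.

End HermiteOperator.

(** * Integration against the Gaussian weight *)

Section GaussianIntegral.
Variable R : realType.
Implicit Types (p q u v : {poly R}) (x a M C : R) (D : set R) (f G : R -> R).
Local Open Scope classical_set_scope.
Notation mu := (@lebesgue_measure R).

Lemma expr_le_expR x n : 0 <= x -> x ^+ n <= n`!%:R * expR x.
Proof.
move=> x0; case: n => [|n].
  by rewrite expr0 fact0 mul1r -expR0 ler_expR.
rewrite mulrC -ler_pdivrMr ?ltr0n ?fact_gt0//.
by rewrite (le_trans _ (expR_ge1Dxn n x0))// lerDr.
Qed.

Lemma poly_le_expR p : exists2 C, 0 <= C & forall x, `|p.[x]| <= C * expR `|x|.
Proof.
exists (\sum_(i < size p) `|p`_i| * i`!%:R).
  by apply: sumr_ge0 => i _; rewrite mulr_ge0.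
move=> x; rewrite horner_coef (le_trans (ler_norm_sum _ _ _))// mulr_suml.
apply: ler_sum => i _; rewrite normrM normrX -mulrA ler_wpM2l//.
exact: expr_le_expR.
Qed.

(** Completing the square in [M * |x| - x^2 / 2]; the remaining half of the Gaussian keeps the bound
    integrable. *)
Lemma expR_gauss_le M x :
  expR (M * `|x|) * gauss_fun x <= expR (M ^+ 2 / 2) * expR (- (x ^+ 2) / 2).
Proof.
rewrite /gauss_fun -!expRD ler_expR -subr_ge0 -(real_normK (num_real x)).
have -> : M ^+ 2 / 2 + - `|x| ^+ 2 / 2 - (M * `|x| + - `|x| ^+ 2) =
  (M - `|x|) ^+ 2 / 2 by field.
by rewrite divr_ge0// sqr_ge0.
Qed.

Lemma integrable_expR_sqr_half :
  mu.-integrable setT (fun x => (expR (- (x ^+ 2) / 2))%:E).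
Proof.
have := integrableZl measurableT (normal_peak (1 : R))^-1
  (integrable_normal_pdf (0 : R) 1).
apply: eq_integrable => // x _.
rewrite normal_pdfE ?oner_eq0// -EFinM mulrA mulVf ?mul1r; last first.
  by rewrite gt_eqF// normal_peak_gt0// oner_eq0.
by rewrite /normal_fun subr0 expr1n.
Qed.

(** The growth class of the integrands and primitives below: its measurable members are integrable,
    and all its members tend to zero at infinity. *)
Definition gauss_dominated f := exists C M, forall x,
  `|f x| <= C * expR (M * `|x|) * gauss_fun x.

Lemma integrable_gauss_dominated D f : measurable D -> measurable_fun setT f ->
  gauss_dominated f -> mu.-integrable D (EFin \o f).
Proof.
move=> mD mf [C [M fC]]; apply: (@integrableS _ _ _ mu setT) => //.
have := integrableZl measurableT (`|C| * expR (M ^+ 2 / 2)) integrable_expR_sqr_half.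
apply: le_integrable => //; first exact/measurable_EFinP.
move=> x _ /=; rewrite lee_fin (le_trans (fC x))// [leRHS]ger0_norm; last first.
  by rewrite !mulr_ge0 ?expR_ge0.
rewrite -mulrA (@le_trans _ _ (`|C| * (expR (M * `|x|) * gauss_fun x)))//.
  by rewrite ler_wpM2r ?ler_norm// mulr_ge0 ?expR_ge0 ?gauss_fun_ge0.
by rewrite -[leRHS]mulrA ler_wpM2l// expR_gauss_le.
Qed.

Lemma gauss_dominated_poly p c f : (forall x, `|f x| <= c * `|p.[x]| * gauss_fun x) ->
  gauss_dominated f.
Proof.
move=> fp; have [C C0 pC] := poly_le_expR p.
exists (`|c| * C), 1 => x; rewrite mul1r (le_trans (fp x))//
  ler_wpM2r ?gauss_fun_ge0//.
rewrite -mulrA (@le_trans _ _ (`|c| * `|p.[x]|))//.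
  by rewrite ler_wpM2r// ler_norm.
by rewrite ler_wpM2l.
Qed.

Lemma cvg_expR_Nnat : (fun n : nat => expR (- (n%:R : R))) @ \oo --> (0 : R).
Proof.
exact: (cvg_comp _ _ (@cvgr_idn R) (@cvgr_expR R)).
Qed.

Lemma gauss_dominated_cvg0 f (b : nat -> R) : gauss_dominated f ->
  (forall n, n%:R <= `|b n|) -> (f \o b) @ \oo --> (0 : R).
Proof.
move=> [C [M fC]] bn.
(* Two completed squares: one absorbs [expR (M * |x|)], the other bounds [exp (- x^2 / 2)] by
   [exp (1/2 - |x|)]. *)
pose K := `|C| * expR (M ^+ 2 / 2) * expR 2^-1.
have fK x : `|f x| <= K * expR (- `|x|).
  rewrite (le_trans (fC x))// /K -mulrA.
  rewrite (@le_trans _ _ (`|C| * (expR (M * `|x|) * gauss_fun x)))//.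
    by rewrite ler_wpM2r ?ler_norm// mulr_ge0 ?expR_ge0 ?gauss_fun_ge0.
  rewrite -[leRHS]mulrA -[leRHS]mulrA ler_wpM2l//
    (le_trans (expR_gauss_le M x))// ler_wpM2l ?expR_ge0//.
  rewrite -expRD ler_expR -subr_ge0 -(real_normK (num_real x)).
  have -> : 2^-1 + - `|x| - - `|x| ^+ 2 / 2 = (1 - `|x|) ^+ 2 / 2 by field.
  by rewrite divr_ge0// sqr_ge0.
have K0 : 0 <= K by rewrite !mulr_ge0 ?expR_ge0.
apply/cvgr0Pnorm_lt => e e0.
have : (fun n : nat => K * expR (- (n%:R : R))) @ \oo --> (0 : R).
  by rewrite -[X in _ --> X](mulr0 K); apply: cvgMr; exact: cvg_expR_Nnat.
move/cvgr0Pnorm_lt => /(_ e e0); apply: filterS => n.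
rewrite ger0_norm ?mulr_ge0 ?expR_ge0//; apply: le_lt_trans.
rewrite (le_trans (fK _))// ler_wpM2l// ler_expR lerN2.
exact: bn.
Qed.

(** The fundamental theorem on [[a n, b n]], then dominated convergence with majorant [|f|] as these
    intervals exhaust [D]. The half-line and the whole line are both instances. *)
Lemma continuous_gauss_FTC f G : continuous f ->
  (forall x, is_derive x (1 : R) G (f x)) -> gauss_dominated f ->
  forall D (a b : nat -> R) (l : R), measurable D -> (forall n, a n < b n) ->
  (forall n, `[a n, b n]%classic `<=` D) ->
  (forall x, D x -> \forall n \near \oo, x \in `[a n, b n]) ->
  (fun n => G (b n) - G (a n)) @ \oo --> l ->
  (\int[mu]_(x in D) f x)%R = l.
Proof.
move=> cf dG fdom D a b l mD ab abD abD' Gl.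
have mf : measurable_fun setT f by exact: continuous_measurable_fun.
have fi := integrable_gauss_dominated mD mf fdom.
have FTC n : (\int[mu]_(x in D) ((EFin \o f) \_ `[a n,
  b n]) x = (G (b n) - G (a n))%:E)%E.
  rewrite -integral_mkcondr (setIidr (abD n)).
  rewrite (continuous_FTC2 (F := G) (ab n))//.
  - exact: continuous_subspaceT.
  - split.
    + by move=> x _; case: (dG x).
    + by apply: cvg_at_right_filter; apply: differentiable_continuous;
        apply/derivable1_diffP; case: (dG (a n)).
    + by apply: cvg_at_left_filter; apply: differentiable_continuous;
        apply/derivable1_diffP; case: (dG (b n)).
  - by move=> x _; rewrite derive1E; case: (dG x).
have dom : (\int[mu]_(x in D) ((EFin \o f) \_ `[a n, b n]) x)%E @[n --> \oo] -->
    (\int[mu]_(x in D) (f x)%:E)%E.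
  apply: (@dominated_cvg _ _ _ mu D mD _ _ (fun x => `|f x|%:E)).
  - move=> n; apply: measurable_funTS; apply/measurable_restrict => //.
      by rewrite setTI; apply: measurable_funTS; exact/measurable_EFinP.
  - move=> x Dx; apply: cvg_near_cst; apply: filterS (abD' x Dx) => n xn.
    by rewrite patchE xn.
  - by [].
  - exact: integrable_norm.
  - move=> n x _; rewrite patchE; case: ifP => _ /=; rewrite ?lee_fin//.
    by rewrite normr0.
rewrite /Rintegral; have -> : (\int[mu]_(x in D) (f x)%:E = l%:E)%E; last by [].
apply: (cvg_unique _ dom) => //; rewrite (_ : (fun n => _) = EFin \o (fun n =>
  G (b n) - G (a n))).
  by apply: cvg_comp Gl _ => //; exact: cvg_EFin.
by apply/funext => n; exact: FTC.
Qed.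

Definition gintegral D p : R := (\int[mu]_(x in D) (p.[x] * gauss_fun x))%R.

Lemma gauss_dominated_horner p : gauss_dominated (fun x => p.[x] * gauss_fun x).
Proof.
apply: (@gauss_dominated_poly p 1) => x.
by rewrite normrM mul1r (ger0_norm (gauss_fun_ge0 x)).
Qed.

Lemma continuous_horner_gauss p : continuous (fun x => p.[x] * gauss_fun x).
Proof.
by move=> x; apply: cvgM; [exact: continuous_horner|exact: continuous_gauss_fun].
Qed.

Lemma integrable_horner_gauss D p : measurable D ->
  mu.-integrable D (fun x => (p.[x] * gauss_fun x)%:E).
Proof.
move=> mD; apply: integrable_gauss_dominated => //.
  by apply: continuous_measurable_fun; exact: continuous_horner_gauss.
exact: gauss_dominated_horner.
Qed.

Lemma gintegralD D p q : measurable D ->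
  gintegral D (p + q) = gintegral D p + gintegral D q.
Proof.
move=> mD; rewrite /gintegral -RintegralD//; try exact: integrable_horner_gauss.
by apply: eq_Rintegral => x _; rewrite hornerD mulrDl.
Qed.

Lemma gintegralZ D (c : R) p : measurable D ->
  gintegral D (c *: p) = c * gintegral D p.
Proof.
move=> mD; rewrite /gintegral -RintegralZl//; try exact: integrable_horner_gauss.
by apply: eq_Rintegral => x _; rewrite hornerZ mulrA.
Qed.

Lemma gintegralZl D (c : R) p q : measurable D ->
  gintegral D (c *: p * q) = c * gintegral D (p * q).
Proof. by move=> mD; rewrite -scalerAl gintegralZ. Qed.

Lemma gintegralZr D (c : R) p q : measurable D ->
  gintegral D (p * (c *: q)) = c * gintegral D (p * q).
Proof. by move=> mD; rewrite -scalerAr gintegralZ. Qed.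

Lemma gintegralB D p q : measurable D ->
  gintegral D (p - q) = gintegral D p - gintegral D q.
Proof. by move=> mD; rewrite gintegralD// -scaleN1r gintegralZ// mulN1r. Qed.

Lemma gintegral0 D : measurable D -> gintegral D 0 = 0.
Proof. by move=> mD; rewrite -(scale0r 0) gintegralZ// mul0r. Qed.

Lemma gintegral_sum D I (r : seq I) (P : pred I) (H : I -> {poly R}) :
  measurable D ->
  gintegral D (\sum_(i <- r | P i) H i) = \sum_(i <- r | P i) gintegral D (H i).
Proof.
move=> mD; apply: (big_morph (gintegral D)); last exact: gintegral0.
by move=> p q; exact: gintegralD.
Qed.

Lemma gintegral_sqr_ge0 D p : 0 <= gintegral D (p ^+ 2).
Proof.
by apply: Rintegral_ge0 => x _; rewrite horner_exp mulr_ge0 ?gauss_fun_ge0 ?sqr_ge0.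
Qed.

Lemma gintegralT x p :
  gintegral setT p = gintegral `]-oo, x[ p + gintegral `[x, +oo[ p.
Proof.
rewrite /gintegral -Rintegral_setU//; last 2 first.
- by apply: (@integrable_horner_gauss _ p); apply: measurableU; exact: measurable_itv.
- rewrite disj_set2E; apply/eqP; rewrite -subset0 => y [] /=.
  by rewrite !in_itv/= andbT => /lt_le_trans /[apply]; rewrite ltxx.
congr (\int[_]_(_ in _) _); apply/seteqP; split => // y _.
by rewrite /= !in_itv/= andbT; have [|] := ltP y x; [left|right].
Qed.

Lemma finite_root p : p != 0 -> finite_set [set x | root p x].
Proof.
move=> p0; apply: contrapT => /(infinite_set_fset (size p)) [B Bp].
apply/negP; rewrite -ltnNge.
have := @max_poly_roots _ p (enum_fset B) p0; apply.
  by apply/allP => x xB; exact: Bp.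
exact: fset_uniq.
Qed.

(** A nonnegative integrand of zero integral vanishes almost everywhere on [D], whereas a nonzero
    polynomial has finitely many roots and [D] contains an interval of positive length. *)
Lemma gintegral_sqr_eq0 D p (a b : R) : a < b -> measurable D -> `[a, b] `<=` D ->
  gintegral D (p ^+ 2) = 0 -> p = 0.
Proof.
move=> ab mD abD p0; apply/eqP; apply/negPn/negP => pn0.
have i := integrable_horner_gauss (p ^+ 2) mD.
have z : (\int[mu]_(x in D) `|((p ^+ 2).[x] * gauss_fun x)%:E| = 0)%E.
  under eq_integral => x _.
    rewrite gee0_abs; last first.
      by rewrite lee_fin mulr_ge0 ?gauss_fun_ge0// horner_exp sqr_ge0.
    over.
  by rewrite -[LHS]fineK ?integrable_fin_num//; congr EFin.
move: z => /(ae_eq_integral_abs mu mD (measurable_int mu i)) z.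
have rn : mu.-negligible [set x | root p x].
  have cr := finite_set_countable (finite_root pn0).
  apply/negligibleP; last exact: countable_lebesgue_measure0.
  by apply: countable_measurable => // t; exact: measurable_set1.
have : mu.-negligible `[a, b].
  apply: negligibleS (negligibleU z rn) => x abx.
  have [px|px] := boolP (root p x); [by right|left => /(_ (abD _ abx))].
  move=> [] /eqP; rewrite mulf_eq0 horner_exp expf_eq0/= -rootE (negbTE px)/=.
  by rewrite gt_eqF// expR_gt0.
move/(negligibleP mu (measurable_itv `[a, b]%R)) => /eqP.
by rewrite /= lebesgue_measure_itv/= lte_fin ab -EFinB eqe subr_eq0 gt_eqF.
Qed.

Lemma is_derive_horner_gauss p x :
  is_derive x (1 : R) (fun y => p.[y] * gauss_fun y)
    ((p^`() - 2 *: 'X * p).[x] * gauss_fun x).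
Proof.
have dg : is_derive x (1 : R) (@gauss_fun R) (gauss_fun x * (- (2 * x))).
  apply: (is_derive1_comp (f := expR)).
  have -> : (fun y : R => - y ^+ 2) = horner (- 'X ^+ 2).
    by apply/funext => y; rewrite !hornerE.
  by apply: is_derive_eq; rewrite derivN derivXn !(hornerE, hornerMn) mulr_natl.
have h := @is_deriveM _ _ _ _ _ _ _ _ (is_derive_poly p x) dg.
apply: is_derive_eq; rewrite !hornerE /= /GRing.scale/=; ring.
Qed.

Lemma gauss_FTCy f G (a : R) : continuous f ->
  (forall x, is_derive x (1 : R) G (f x)) -> gauss_dominated f ->
  gauss_dominated G -> (\int[mu]_(x in `[a, +oo[) f x)%R = - G a.
Proof.
move=> cf dG fd Gd.
(* The summand [n.+1], not [n], keeps the first interval nondegenerate. *)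
apply: (continuous_gauss_FTC cf dG fd (a := fun=> a) (b := fun n => `|a| + n.+1%:R)).
- exact: measurable_itv.
- move=> n; rewrite (le_lt_trans (ler_norm a))// ltrDl ltr0n//.
- by move=> n x /=; rewrite !in_itv/= andbT => /andP[].
- move=> x /=; rewrite in_itv/= andbT => ax.
  near=> n; rewrite inE/= in_itv/= ax/=.
  have : x <= n%:R by near: n; exact: nbhs_infty_ger.
  move=> /le_trans; apply; rewrite -natr1 addrCA lerDl addr_ge0//.
- rewrite -[X in _ --> X]add0r; apply: cvgB; last exact: cvg_cst.
  apply: (gauss_dominated_cvg0 Gd) => n.
  by rewrite (le_trans _ (ler_norm _))// -natr1 addrCA lerDl addr_ge0.
Unshelve. all: by end_near. Qed.

Lemma gauss_FTCT f G : continuous f ->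
  (forall x, is_derive x (1 : R) G (f x)) -> gauss_dominated f ->
  gauss_dominated G -> (\int[mu]_x f x)%R = 0.
Proof.
move=> cf dG fd Gd.
apply: (continuous_gauss_FTC cf dG fd (a := fun n => - n.+1%:R) (b := fun n =>
  n.+1%:R)).
- exact: measurableT.
- by move=> n; rewrite (@lt_trans _ _ 0)// ?oppr_lt0 ltr0n.
- by [].
- move=> x _; near=> n; rewrite inE/= in_itv/= -ler_norml.
  have : `|x| <= n%:R by near: n; exact: nbhs_infty_ger.
  by move=> /le_trans; apply; rewrite ler_nat.
- rewrite -[X in _ --> X]subr0; apply: cvgB.
    by apply: (gauss_dominated_cvg0 Gd) => n; rewrite ger0_norm// ler_nat.
  by apply: (gauss_dominated_cvg0 Gd) => n; rewrite normrN ger0_norm// ler_nat.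
Unshelve. all: by end_near. Qed.

Lemma gintegral_derivy p a :
  gintegral `[a, +oo[ (p^`() - 2 *: 'X * p) = - (p.[a] * gauss_fun a).
Proof.
apply: (gauss_FTCy (G := fun x => p.[x] * gauss_fun x)).
- exact: continuous_horner_gauss.
- exact: is_derive_horner_gauss.
- exact: gauss_dominated_horner.
- exact: gauss_dominated_horner.
Qed.

Lemma gintegral_derivT p : gintegral setT (p^`() - 2 *: 'X * p) = 0.
Proof.
apply: (gauss_FTCT (G := fun x => p.[x] * gauss_fun x)).
- exact: continuous_horner_gauss.
- exact: is_derive_horner_gauss.
- exact: gauss_dominated_horner.
- exact: gauss_dominated_horner.
Qed.

End GaussianIntegral.

(** * Green's identity, Hermite orthogonality and orders of vanishing *)

Section Green.
Variable R : realType.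
Implicit Types (p q u v : {poly R}) (x a : R) (s : seq nat) (f : nat).
Local Notation J a := (gintegral `[a, +oo[%classic).

(** Lagrange's identity: [(A v) w = - (v' w)' / 2], so the left side times [w] is the derivative of
    [- (u v' - u' v) w / 2]; the terms in [f] cancel. *)
Lemma hshift_green f u v : u * hshift f v - hshift f u * v =
  - 2^-1 *: ((u * v^`() - u^`() * v)^`() - 2 *: 'X * (u * v^`() - u^`() * v)).
Proof.
rewrite /hshift /hop derivB !derivM -!mul_polyC.
set c := (2^-1)%:P; have -> : (- 2^-1)%:P = - c by rewrite polyCN.
have c2 : 2%:P * c = 1 by rewrite -polyCM mulfV ?pnatr_eq0.
transitivity ((2%:P * c) * 'X * (u * v^`() - u^`() * v) -
  c * (u * v^`()^`() - u^`()^`() * v)); last by ring.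
by rewrite c2; ring.
Qed.

Lemma gintegral_green f u v a :
  J a (u * hshift f v) - J a (hshift f u * v) =
  2^-1 * (u * v^`() - u^`() * v).[a] * gauss_fun a.
Proof.
rewrite -gintegralB; last exact: measurable_itv.
rewrite hshift_green gintegralZ; last exact: measurable_itv.
by rewrite gintegral_derivy mulrNN mulrA.
Qed.

Lemma gintegral_greenT f u v :
  gintegral setT (u * hshift f v) = gintegral setT (hshift f u * v).
Proof.
apply/eqP; rewrite -subr_eq0 -gintegralB; last exact: measurableT.
by rewrite hshift_green gintegralZ ?gintegral_derivT ?mulr0.
Qed.

(** Self-adjointness of [A] gives [(n - m) <H_n, H_m> = 0]. *)
Lemma hermite_orthogonal n m : n != m ->
  gintegral setT (hermite R n * hermite R m) = 0.
Proof.
move=> nm; have := gintegral_greenT m (hermite R n) (hermite R m).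
rewrite /hshift !hermite_eigen subrr mulr0 gintegral0// -scalerBl -scalerAl.
rewrite gintegralZ// => /esym/eqP; rewrite mulf_eq0 subr_eq0 eqr_nat (negbTE nm).
by move/eqP.
Qed.

Lemma hermite_norm_gt0 n : 0 < gintegral setT (hermite R n * hermite R n).
Proof.
rewrite -expr2 lt_neqAle gintegral_sqr_ge0 andbT eq_sym; apply/eqP => h.
have : hermite R n = 0.
  by apply: (gintegral_sqr_eq0 (a := 0) (b := 1)) h; rewrite ?ltr01.
by move/(congr1 (fun p : {poly R} => size p)); rewrite size_hermite size_poly0.
Qed.

Definition vanish r u x := forall i, (i < r)%N -> u^`(i).[x] = 0.

(** Leibniz's rule for [X u']. The formula shows that each factor [A - f] costs two orders of
    vanishing. *)
Lemma derivn_hshift f u i x : (hshift f u)^`(i).[x] =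
  x * u^`(i.+1).[x] + (i%:R - f%:R) * u^`(i).[x] - 2^-1 * u^`(i.+2).[x].
Proof.
have -> : (hshift f u)^`(i) =
    'X * u^`(i.+1) + (i%:R - f%:R) *: u^`(i) - 2^-1 *: u^`(i.+2).
  elim: i => [|i IH]; first by rewrite /hshift
    /hop sub0r scaleNr addrAC -addrA addrCA addrC.
  rewrite derivnS IH derivB derivD derivM derivX mul1r !derivZ -!derivnS.
  by rewrite -natr1 -!mul_polyC !polyCD !polyCN; ring.
by rewrite !hornerE.
Qed.

Lemma vanish_hshift r f u x : vanish r.+2 u x -> vanish r (hshift f u) x.
Proof.
by move=> ux i ir; rewrite derivn_hshift !ux ?mulr0 ?addr0 ?subr0//; lia.
Qed.

Lemma vanishW r r' u x : (r' <= r)%N -> vanish r u x -> vanish r' u x.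
Proof. by move=> rr ux i ir; apply: ux; exact: leq_trans rr. Qed.

Lemma vanish_hops s r u x :
  vanish (r + (size s).*2) u x -> vanish r (hops s u) x.
Proof.
elim: s r => [|f s IH] r /=; first by rewrite addn0.
by rewrite doubleS !addnS => ux; apply: vanish_hshift; apply: IH; rewrite !addSn.
Qed.

(** At a zero of such high order only the second-derivative part of each factor contributes. *)
Lemma derivn_hops s r u x : vanish (r + (size s).*2) u x ->
  (hops s u)^`(r).[x] = (- 2^-1) ^+ size s * u^`(r + (size s).*2).[x].
Proof.
elim: s r => [|f s IH] r /=; first by rewrite addn0 expr0 mul1r.
rewrite doubleS !addnS => ux.
have v : vanish r.+2 (hops s u) x by apply: vanish_hops; rewrite !addSn.
rewrite derivn_hshift (v r.+1)// (v r)// (IH r.+2) ?addSn//.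
by rewrite !mulr0 add0r sub0r exprS mulNr mulNr mulrA.
Qed.

(** Each boundary term at [a] is linear in the value and first derivative of the left factor, and
    these vanish at every stage. *)
Lemma gintegral_hops s u v a : vanish (size s).*2 u a ->
  J a (u * hops s v) = J a (hops s u * v).
Proof.
elim: s u => [|f s IH] u //=; rewrite doubleS => ua.
have := gintegral_green f u (hops s v) a.
have u0 : u.[a] = 0 by rewrite -(ua 0%N).
have u1 : u^`().[a] = 0 by rewrite -derivn1 ua.
rewrite hornerD hornerN !hornerM u0 u1 !mul0r subr0 mulr0 mul0r => /eqP.
rewrite subr_eq0 => /eqP ->.
by rewrite IH; [rewrite hops_hshift|exact: vanish_hshift].
Qed.

(* Only one boundary term survives when the operators are moved from [v] to
   [u] one at a time: the orders of vanishing of the two factors add up to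
   [1] at every step. *)
Lemma gintegral_hops_boundary s1 f s2 u v a :
  size s2 = (size s1).+1 ->
  vanish (size s1).*2.+1 u a -> vanish (size s2).*2 v a ->
  hops (s1 ++ f :: s2) u = 0 ->
  J a (u * hops (s1 ++ f :: s2) v) =
  - 2^-1 * (- 2^-1) ^+ (size s1 + size s2) * u^`((size s1).*2.+1).[a] *
    v^`((size s2).*2).[a] * gauss_fun a.
Proof.
move=> ss ua va u0; rewrite hops_cat gintegral_hops; last exact: vanishW ua.
have /= := gintegral_green f (hops s1 u) (hops s2 v) a.
(* Moving the factors of [s2] off [v], which vanishes to sufficient order, completes the full
   product acting on [u], which is zero. *)
have -> : J a (hshift f (hops s1 u) * hops s2 v) = 0.
  rewrite mulrC -gintegral_hops// -[hshift f _]/(hops (f :: s1) u) hopsC.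
  by rewrite -hops_cat (_ : hops _ u = 0) ?mulr0 ?gintegral0// -u0 !hops_cat /=
    hops_hshift.
rewrite subr0 => ->.
have u10 : (hops s1 u).[a] = 0.
  by rewrite -[hops s1 u]derivn0 (@derivn_hops s1 0) ?ua ?mulr0//; exact: vanishW ua.
rewrite hornerD hornerN !hornerM u10 mul0r sub0r -derivn1.
rewrite (@derivn_hops s1 1)// -[hops s2 v]derivn0 (@derivn_hops s2 0)//
  exprD add0n add1n.
by ring.
Qed.

End Green.

(** * Density of polynomials *)

Section PolynomialDensity.
Variable R : realType.
Notation T := (measurableTypeR R).
Variables (mu : {measure set T -> \bar R}) (r : {poly R}).
Hypothesis r_exp : forall M : R,
  mu.-integrable setT (fun x : T => (r.[x] ^+ 2 * expR (M * `|x|))%:E).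
Local Open Scope classical_set_scope.
Implicit Types (f g u v : T -> R) (p q : {poly R}).

Lemma measurable_horner p : measurable_fun [set: T] (horner p).
Proof. by apply: continuous_measurable_fun; exact: continuous_horner. Qed.

Lemma integral_sqrD_le u v : measurable_fun [set: T] u -> measurable_fun [set: T] v ->
  (\int[mu]_x ((u x + v x) ^+ 2)%:E <=
   2%:E * \int[mu]_x (u x ^+ 2)%:E + 2%:E * \int[mu]_x (v x ^+ 2)%:E)%E.
Proof.
move=> mU mv.
have mX f : measurable_fun [set: T] f -> measurable_fun [set: T] (fun x =>
  (f x ^+ 2)%:E).
  by move=> mf; apply/measurable_EFinP; exact: measurable_funX.
have ge0 f x : (0 <= (f x ^+ 2)%:E)%E by rewrite lee_fin sqr_ge0.
rewrite -!ge0_integralZl//; try exact: mX.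
rewrite -ge0_integralD//.
- apply: ge0_le_integral => //.
  + by apply: mX; exact: measurable_funD.
  + by apply: emeasurable_funD; apply: measurable_funeM; exact: mX.
  + move=> x _; rewrite -!EFinM -EFinD lee_fin -subr_ge0.
    have -> : 2 * u x ^+ 2 + 2 * v x ^+ 2 - (u x + v x) ^+ 2 = (u x - v x) ^+ 2.
      by ring.
    exact: sqr_ge0.
- by move=> x _; rewrite mule_ge0.
- by apply: measurable_funeM; exact: mX.
- by move=> x _; rewrite mule_ge0.
- by apply: measurable_funeM; exact: mX.
Qed.

Lemma lte_quarterD (a b : \bar R) (e : R) : (a < (e / 4)%:E)%E -> (b < (e
  / 4)%:E)%E ->
  (2%:E * a + 2%:E * b < e%:E)%E.
Proof.
move=> ae be; have -> : (e%:E = 2%:E * (e / 4)%:E + 2%:E * (e / 4)%:E)%E.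
  by rewrite -!EFinM -EFinD; congr EFin; field.
by apply: lteD; rewrite lte_pmul2l.
Qed.

(** The closure in [L^2(mu)] of the polynomial multiples of [r]. The lemmas below place in it,
    successively, [r] times the indicators of sign sets of sines, of half-lines and of Borel sets,
    then [r] times simple and nonnegative functions. *)
Definition approximable f := measurable_fun [set: T] f /\
  forall e : R, 0 < e ->
    exists q, (\int[mu]_x ((f x - r.[x] * q.[x]) ^+ 2)%:E < e%:E)%E.

Lemma approximable_poly p : approximable (fun x => r.[x] * p.[x]).
Proof.
split; first by apply: measurable_funM; exact: measurable_horner.
move=> e e0; exists p; under eq_integral do rewrite subrr expr0n/=.
by rewrite integral0 lte_fin.
Qed.

Lemma approximableD u v :
  approximable u -> approximable v -> approximable (fun x => u x + v x).
Proof.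
move=> [mU au] [mv av]; split; first exact: measurable_funD.
move=> e e0; have e4 : 0 < e / 4 by rewrite divr_gt0.
have [p up] := au _ e4; have [q vq] := av _ e4.
exists (p + q); rewrite (_ : (fun x => _) = (fun x =>
  (((u x - r.[x] * p.[x]) + (v x - r.[x] * q.[x])) ^+ 2)%:E)); last first.
  by apply/funext => x; rewrite hornerD mulrDr opprD addrACA.
apply: le_lt_trans.
  by apply: integral_sqrD_le; apply: measurable_funB => //;
    apply: measurable_funM; exact: measurable_horner.
exact: lte_quarterD.
Qed.

Lemma approximableZ (c : R) u :
  approximable u -> approximable (fun x => c * u x).
Proof.
move=> [mU au]; split; first exact: measurable_funM.
move=> e e0; have c1 : 0 < c ^+ 2 + 1 by rewrite ltr_wpDl ?sqr_ge0.
have ec : 0 < e / (c ^+ 2 + 1) by rewrite divr_gt0.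
have [p up] := au _ ec; exists (c *: p).
have -> : (fun x : T => ((c * u x - r.[x] * (c *: p).[x]) ^+ 2)%:E) =
    (fun x => (c ^+ 2)%:E * ((u x - r.[x] * p.[x]) ^+ 2)%:E)%E.
  by apply/funext => x; rewrite -EFinM hornerZ; congr EFin; ring.
rewrite ge0_integralZl//; last 3 first.
- apply/measurable_EFinP/measurable_funX/measurable_funB => //.
  by apply: measurable_funM; exact: measurable_horner.
- by move=> x _; rewrite lee_fin sqr_ge0.
- by rewrite lee_fin sqr_ge0.
apply: (@le_lt_trans _ _ ((c ^+ 2 + 1)%:E * \int[mu]_x ((u x - r.[x] * p.[x])
  ^+ 2)%:E)%E).
  rewrite lee_wpmul2r ?lee_fin ?lerDl//.
  by apply: integral_ge0 => x _; rewrite lee_fin sqr_ge0.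
have -> : (e%:E = (c ^+ 2 + 1)%:E * (e / (c ^+ 2 + 1))%:E)%E.
  by rewrite -EFinM mulrC divfK// gt_eqF.
by rewrite lte_pmul2l.
Qed.

Lemma approximableB u v :
  approximable u -> approximable v -> approximable (fun x => u x - v x).
Proof.
move=> au av; have := approximableD au (approximableZ (-1) av).
by congr approximable; apply/funext => x; rewrite mulN1r.
Qed.

(** Dominated convergence, with majorant [4 * g ^+ 2], makes some [f_ n] close to [f]; a multiple of
    [r] close to that [f_ n] then serves for [f]. *)
Lemma approximable_cvg (f_ : nat -> T -> R) f g :
  (forall n, approximable (f_ n)) -> (forall x, f_ n x @[n --> \oo] --> f x) ->
  (forall n x, `|f_ n x| <= g x) -> mu.-integrable setT (fun x => (g x ^+ 2)%:E) ->
  approximable f.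
Proof.
move=> af f_f fg ig.
have mf_ n : measurable_fun [set: T] (f_ n) by case: (af n).
have mf : measurable_fun [set: T] f.
  by apply: measurable_fun_cvg mf_ _ => x _; exact: f_f.
split=> // e e0; have e4 : 0 < e / 4 by rewrite divr_gt0.
have fgx x : `|f x| <= g x.
  by apply: (ler_cvg_to (cvg_norm (f_f x)) (@cvg_cst _ (g x) _ _ _)); exact: nearW.
have lim0 : (\int[mu]_x ((f x - f_ n x) ^+ 2)%:E @[n --> \oo] --> \int[mu]_(x
  in setT) (0%:E))%E.
  apply: (@dominated_cvg _ _ _ mu setT measurableT _ _ (fun x =>
    4%:E * (g x ^+ 2)%:E)%E) => //.
  - by move=> n; apply/measurable_EFinP/measurable_funX/measurable_funB.
  - move=> x _; apply: cvg_EFin; first exact: nearW.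
    have h : (fun n => (f x - f_ n x) ^+ 2) @ \oo --> ((f x - f x) ^+ 2 : R).
      under eq_fun do rewrite expr2; rewrite expr2.
      by apply: cvgM; apply: cvgB => //; exact: cvg_cst.
    by rewrite subrr expr0n in h.
  - exact: integrableZl.
  - move=> n x _; rewrite -EFinM lee_fin ger0_norm ?sqr_ge0//.
    have -> : 4 * g x ^+ 2 = (2 * g x) ^+ 2 by ring.
    rewrite -(real_normK (num_real (f x - f_ n x))) lerXn2r ?nnegrE//.
      by rewrite mulr_ge0// (le_trans _ (fgx x)).
    by rewrite (le_trans (ler_normB _ _))// mulr_natl mulr2n lerD.
rewrite integral0 in lim0.
have [n ln] : exists n, (\int[mu]_x ((f x - f_ n x) ^+ 2)%:E < (e / 4)%:E)%E.
  have [fin0 lim1] := (fine_cvgP _ _).1 lim0.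
  have [N _ H] := filterI fin0 (cvgr_lt _ lim1 _ e4).
  by exists N; have [/= fN] := H N (leqnn N); rewrite -lte_fin fineK.
have [q aq] := (af n).2 _ e4; exists q.
have -> : (fun x : T => ((f x - r.[x] * q.[x]) ^+ 2)%:E) =
    (fun x => (((f x - f_ n x) + (f_ n x - r.[x] * q.[x])) ^+ 2)%:E).
  by apply/funext => x; rewrite subrKA.
apply: le_lt_trans.
  apply: integral_sqrD_le; apply: measurable_funB => //.
  by apply: measurable_funM; exact: measurable_horner.
exact: lte_quarterD.
Qed.

(* The exponential bound is what makes dominated convergence against
   [r ^+ 2 * mu] available. *)
Definition exp_limit f := exists (p : nat -> {poly R}) (C M : R),
  (forall n x, `|(p n).[x]| <= C * expR (M * `|x|)) /\
  forall x, (p n).[x] @[n --> \oo] --> f x.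

Lemma exp_limit_poly p : exp_limit (horner p).
Proof.
have [C _ pC] := poly_le_expR p; exists (fun=> p), C, 1; split=> [n x|x].
  by rewrite mul1r.
exact: cvg_cst.
Qed.

Lemma exp_boundW (C M N x : R) : M <= N ->
  C * expR (M * `|x|) <= `|C| * expR (N * `|x|).
Proof.
move=> MN; rewrite (@le_trans _ _ (`|C| * expR (M * `|x|)))//.
  by rewrite ler_wpM2r ?expR_ge0 ?ler_norm.
by rewrite ler_wpM2l// ler_expR ler_wpM2r.
Qed.

Lemma exp_limitD f g : exp_limit f -> exp_limit g -> exp_limit (fun x => f x + g x).
Proof.
move=> [p [C [M [pC pf]]]] [q [D [N [qD qg]]]].
exists (fun n => p n + q n), (`|C| + `|D|), (Num.max M N); split=> [n x|x].
  rewrite hornerD (le_trans (ler_normD _ _))// mulrDl lerD//.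
    by rewrite (le_trans (pC n x))// exp_boundW// le_max lexx.
  by rewrite (le_trans (qD n x))// exp_boundW// le_max lexx orbT.
by under eq_fun do rewrite hornerD; exact: cvgD.
Qed.

Lemma exp_limitM f g : exp_limit f -> exp_limit g -> exp_limit (fun x => f x * g x).
Proof.
move=> [p [C [M [pC pf]]]] [q [D [N [qD qg]]]].
exists (fun n => p n * q n), (C * D), (M + N); split=> [n x|x].
  by rewrite hornerM normrM mulrDl expRD mulrACA ler_pM.
by under eq_fun do rewrite hornerM; exact: cvgM.
Qed.

Lemma exp_limit_cst (c : R) : exp_limit (fun=> c).
Proof.
have := exp_limit_poly c%:P; congr exp_limit.
by apply/funext => x; rewrite hornerC.
Qed.

Lemma exp_limitX f n : exp_limit f -> exp_limit (fun x => f x ^+ n).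
Proof.
move=> ef; elim: n => [|n IH].
  by have := exp_limit_cst 1; congr exp_limit; apply/funext => x; rewrite expr0.
have := exp_limitM ef IH; congr exp_limit.
by apply/funext => x; rewrite exprS.
Qed.

Lemma exp_coeff_sum_le (y : R) n : 0 <= y -> \sum_(0 <= k < n) exp_coeff y k <=
  expR y.
Proof.
move=> y0; apply: (nondecreasing_cvgn_le _ (is_cvg_series_exp_coeff y) n).
apply: nondecreasing_series => k _ _; rewrite /exp_coeff /=.
by rewrite mulr_ge0 ?exprn_ge0 ?invr_ge0.
Qed.

(** The partial sums of the sine series at [a * (x - b)] are bounded by [expR |a * (x - b)|],
    whatever the number of terms. *)
Lemma exp_limit_sin (a b : R) : exp_limit (fun x => sin (a * (x - b))).
Proof.
pose p n : {poly R} := \sum_(0 <= k < n)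
  (((odd k)%:R * (-1) ^+ k.-1./2) / k`!%:R) *: (a *: ('X - b%:P)) ^+ k.
have pE n x : (p n).[x] = series (sin_coeff (a * (x - b))) n.
  rewrite /p horner_sum /series /=; apply: eq_bigr => k _.
  by rewrite hornerZ horner_exp hornerZ hornerXsubC /sin_coeff/= mulrAC.
exists p, (expR (`|a| * `|b|)), `|a|; split=> [n x|x].
  rewrite pE /series /= (le_trans (ler_norm_sum _ _ _))//.
  apply: (@le_trans _ _ (expR `|a * (x - b)|)); last first.
    rewrite -expRD ler_expR normrM -mulrDr ler_wpM2l// [leRHS]addrC.
    exact: ler_normB.
  apply: le_trans (exp_coeff_sum_le n (normr_ge0 _)).
  apply: ler_sum => k _; rewrite /sin_coeff /exp_coeff /= !normrM normrX.
  rewrite (@ger0_norm _ (k`!%:R^-1)) ?invr_ge0// ler_wpM2r ?invr_ge0//.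
  rewrite normrN1 expr1n mulr1 normrX normrM ler_piMl ?exprn_ge0 ?mulr_ge0//.
  by case: (odd k); rewrite ?normr1 ?normr0.
under eq_fun do rewrite pE; rewrite unlock.
exact: is_cvg_series_sin_coeff.
Qed.

Lemma approximable_exp_limit f : exp_limit f -> approximable (fun x => r.[x] * f x).
Proof.
move=> [p [C [M [pC pf]]]].
apply: (@approximable_cvg (fun n x => r.[x] * (p n).[x]) _
  (fun x => `|r.[x]| * (C * expR (M * `|x|)))).
- by move=> n; exact: approximable_poly.
- by move=> x; apply: cvgM; [exact: cvg_cst|exact: pf].
- by move=> n x; rewrite normrM ler_wpM2l.
- have := integrableZl measurableT (C ^+ 2) (r_exp (2 * M)).
  apply: eq_integrable => // x _; rewrite -EFinM; congr EFin.
  by rewrite !exprMn real_normK ?num_real// -[2 * M * _]mulrA expRM_natl; ring.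
Qed.

(** With [t = sqrt s], the product [n * t ^+ n] stays below [1 / (1 - t)], and the other factor
    [t ^+ n] tends to zero. *)
Lemma geometric_linear_cvg0 (s : R) : 0 <= s < 1 -> (fun n : nat =>
  n%:R * s ^+ n) @ \oo --> (0 : R).
Proof.
move=> /andP[s0 s1].
pose t := Num.sqrt s; have t0 : 0 <= t by rewrite sqrtr_ge0.
have tE : t ^+ 2 = s by rewrite sqr_sqrtr.
have t1 : t < 1 by rewrite -(sqrtr1 R) ltr_sqrt.
have nt (n : nat) : n%:R * t ^+ n <= (1 - t)^-1.
  rewrite -[leRHS]mul1r ler_pdivlMr ?subr_gt0//.
  apply: (@le_trans _ _ (1 - t ^+ n)); last by rewrite gerBl exprn_ge0.
  elim: n => [|n IH]; first by rewrite !mul0r expr0 subrr.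
  rewrite -natr1 exprS -subr_ge0.
  have -> : 1 - t * t ^+ n - (n%:R + 1) * (t * t ^+ n) * (1 - t) =
    t * (1 - t ^+ n - n%:R * t ^+ n * (1 - t)) + (1 - t) * (1 - t ^+ n.+1).
    by rewrite exprS; ring.
  rewrite addr_ge0// mulr_ge0 ?subr_ge0// ?(ltW t1)//.
  by rewrite exprn_ile1// ltW.
have gt0 : (fun n : nat => (1 - t)^-1 * t ^+ n) @ \oo --> (0 : R).
  rewrite -[X in _ --> X](mulr0 (1 - t)^-1); apply: cvgMr.
  by apply: cvg_expr; rewrite ger0_norm.
apply: (squeeze_cvgr _ (cvg_cst 0) gt0); apply: nearW => n.
rewrite mulr_ge0 ?exprn_ge0//= -tE -exprM mul2n -addnn exprD mulrA.
by rewrite ler_wpM2r ?exprn_ge0.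
Qed.

(* On [[0, 1]] this tends to the indicator of [[1/2, 1]]; the factor [n] in the
   exponent settles the limit at [1/2]. *)
Definition step_approx n (t : R) : R := 1 - (1 - t ^+ n) ^+ (n * 2 ^ n).

Lemma step_approx_bound n t : 0 <= t <= 1 -> 0 <= step_approx n t <= 1.
Proof.
move=> /andP[t0 t1]; have tn0 : 0 <= t ^+ n by rewrite exprn_ge0.
have tn1 : t ^+ n <= 1 by rewrite exprn_ile1.
by rewrite subr_ge0 gerBl exprn_ge0 ?exprn_ile1 ?gerBl ?subr_ge0.
Qed.

Lemma bernoulli_ge (y : R) m : 0 <= y -> 1 + m%:R * y <= (1 + y) ^+ m.
Proof.
move=> y0; elim: m => [|m IH]; first by rewrite mul0r addr0 expr0.
rewrite exprS (le_trans _ (ler_wpM2l _ IH)) ?addr_ge0// -natr1 -subr_ge0.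
have -> : (1 + y) * (1 + m%:R * y) - (1 + (m%:R + 1) * y) = m%:R * y ^+ 2 by ring.
by rewrite mulr_ge0 ?sqr_ge0.
Qed.

Lemma bernoulli_le (y : R) m : 0 <= y <= 1 -> 1 - m%:R * y <= (1 - y) ^+ m.
Proof.
move=> /andP[y0 y1]; elim: m => [|m IH]; first by rewrite mul0r subr0 expr0.
rewrite exprS (le_trans _ (ler_wpM2l _ IH)) ?subr_ge0// -natr1 -subr_ge0.
have -> : (1 - y) * (1 - m%:R * y) - (1 - (m%:R + 1) * y) = m%:R * y ^+ 2 by ring.
by rewrite mulr_ge0 ?sqr_ge0.
Qed.

(** Put [y = t ^+ n] and [m = n * 2 ^ n]. If [t >= 1/2], then [m * y >= n], so Bernoulli and
    [(1 - y)^m (1 + y)^m <= 1] bound [(1 - y)^m] by [1 / (n + 1)]. If [t < 1/2], Bernoulli bounds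
    [1 - (1 - y)^m] by [n (2 t)^n]. *)
Lemma step_approx_cvg t : 0 <= t <= 1 ->
  step_approx n t @[n --> \oo] --> ((2^-1 <= t)%R%:R : R).
Proof.
move=> /andP[t0 t1].
have tn0 n : 0 <= t ^+ n by rewrite exprn_ge0.
have tn1 n : t ^+ n <= 1 by rewrite exprn_ile1.
have [t2|t2] := leP 2^-1 t.
  rewrite -[X in _ --> X]subr0; apply: cvgB; first exact: cvg_cst.
  apply: (squeeze_cvgr _ (cvg_cst 0) (@cvg_harmonic R)); apply: nearW => n.
  rewrite exprn_ge0 ?subr_ge0//=.
  rewrite -[leRHS]mul1r ler_pdivlMr ?ltr0n//.
  have b : n.+1%:R <= (1 + t ^+ n) ^+ (n * 2 ^ n).
    rewrite (le_trans _ (bernoulli_ge _ (tn0 n)))// -natr1 addrC lerD2l.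
    rewrite natrM -mulrA ler_peMr// natrX -exprMn exprn_ege1//.
    by rewrite -(ler_pM2l (x := 2^-1)) ?invr_gt0//
      mulr1 mulrA mulVf ?mul1r ?pnatr_eq0.
  rewrite (le_trans (ler_wpM2l _ b)) ?exprn_ge0 ?subr_ge0//.
  rewrite -exprMn exprn_ile1// ?mulr_ge0 ?subr_ge0 ?addr_ge0//.
  have -> : (1 - t ^+ n) * (1 + t ^+ n) = 1 - (t ^+ n) ^+ 2 by ring.
  by rewrite gerBl sqr_ge0.
have s01 : 0 <= 2 * t < 1.
  by rewrite mulr_ge0//= mulrC -ltr_pdivlMr// div1r.
apply: (squeeze_cvgr _ (cvg_cst 0) (geometric_linear_cvg0 s01)); apply: nearW => n.
have := @step_approx_bound n t; rewrite t0 t1 => /(_ isT)/andP[-> _]/=.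
rewrite /step_approx lerBlDl -lerBlDr (le_trans _ (bernoulli_le _ _)) ?tn0 ?tn1//.
by rewrite natrM natrX exprMn mulrA.
Qed.

Lemma approximable_sin_ge0 (a b : R) :
  approximable (fun x => r.[x] * (0 <= sin (a * (x - b)))%R%:R).
Proof.
(* Rescaled to [[0, 1]], the condition that the sine is nonnegative becomes [t x >= 1/2], the
   threshold of [step_approx]. *)
pose t x := (1 + sin (a * (x - b))) / 2.
have t01 x : 0 <= t x <= 1.
  have := sin_geN1 (a * (x - b)); have := sin_le1 (a * (x - b)).
  by rewrite /t => *; apply/andP; split; lra.
have et : exp_limit t.
  by apply: exp_limitM (exp_limit_cst _);
    apply: exp_limitD (exp_limit_sin _ _); exact: exp_limit_cst.
apply: (@approximable_cvg (fun n x => r.[x] * step_approx n (t x)) _ (fun x =>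
  `|r.[x]|)).
- move=> n; apply: approximable_exp_limit; rewrite /step_approx.
  have -> : (fun x => 1 - (1 - t x ^+ n) ^+ (n * 2 ^ n)) =
    (fun x => 1 + (-1) * (1 + (-1) * t x ^+ n) ^+ (n * 2 ^ n)).
    by apply/funext => x; rewrite !mulN1r.
  apply: exp_limitD (exp_limit_cst _) _; apply: exp_limitM (exp_limit_cst _) _.
  apply: exp_limitX; apply: exp_limitD (exp_limit_cst _) _.
  by apply: exp_limitM (exp_limit_cst _) _; exact: exp_limitX.
- move=> x; apply: cvgM; first exact: cvg_cst.
  have -> : (0 <= sin (a * (x - b))) = (2^-1 <= t x).
    by rewrite /t; apply/idP/idP => *; lra.
  exact: step_approx_cvg.
- move=> n x; rewrite normrM ler_piMr//.
  by have /andP[h0 h1] := step_approx_bound n (t01 x); rewrite ger0_norm.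
- have := r_exp 0; apply: eq_integrable => // x _.
  by rewrite mul0r expR0 mulr1 real_normK ?num_real.
Qed.

(** A slow sine detects the half-line: once [|x - b| <= n], the argument [(x - b) / (n + 1)] lies in
    []-pi, pi[], where the sign of the sine is that of [x - b]. *)
Lemma approximable_ge (b : R) : approximable (fun x => r.[x] * \1_(`[b, +oo[) x).
Proof.
apply: (@approximable_cvg
  (fun n x => r.[x] * (0 <= sin (n.+1%:R^-1 * (x - b)))%R%:R) _ (fun x => `|r.[x]|)).
- by move=> n; exact: approximable_sin_ge0.
- move=> x; apply: cvgM; first exact: cvg_cst.
  apply: cvg_near_cst; near=> n.
  have nx : `|x - b| <= n%:R by near: n; exact: nbhs_infty_ger.
  have npi : `|n.+1%:R^-1 * (x - b)| < pi.
    rewrite normrM ger0_norm ?invr_ge0// mulrC ltr_pdivrMr ?ltr0n//.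
    rewrite (le_lt_trans nx)// (@lt_le_trans _ _ (1 * n.+1%:R))//.
      by rewrite mul1r ltr_nat.
    by rewrite ler_wpM2r// (le_trans _ (pi_ge2 R))// ler1n.
  rewrite indicE mem_setE in_itv/= andbT; congr (_%:R); congr nat_of_bool.
  have n0 : 0 < n.+1%:R^-1 :> R by rewrite invr_gt0 ltr0n.
  have [bx|xb] := leP b x.
    apply: sin_ge0_pi; rewrite mulr_ge0 ?subr_ge0 ?(ltW n0)//=.
    by rewrite (le_trans (ler_norm _))// ltW.
  apply/negP/negP; rewrite -ltNge -oppr_gt0 -sinN; apply: sin_gt0_pi.
  rewrite oppr_gt0 pmulr_rlt0// subr_lt0 xb/=.
  by rewrite (le_lt_trans (ler_norm _))// normrN.
- by move=> n x; rewrite normrM ler_piMr//; case: (0 <= _); rewrite ?normr1 ?normr0.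
- have := r_exp 0; apply: eq_integrable => // x _.
  by rewrite mul0r expR0 mulr1 real_normK ?num_real.
Unshelve. all: by end_near. Qed.

Lemma integrable_sqr_weight : mu.-integrable setT (fun x : T => (`|r.[x]| ^+ 2)%:E).
Proof.
have := r_exp 0; apply: eq_integrable => // x _.
by rewrite mul0r expR0 mulr1 real_normK ?num_real.
Qed.

(** The sets with this property form a lambda-system containing the half-lines [[b, +oo[], which are
    stable under intersection and generate the Borel sets. *)
Lemma approximable_indic (A : set T) : measurable A ->
  approximable (fun x => r.[x] * \1_A x).
Proof.
pose H (B : set R) := approximable (fun x => r.[x] * \1_B x).
suff HA : (@RGenCInfty.G R).-sigma.-measurable `<=` H.
  by move=> mA; apply: HA; rewrite -RGenCInfty.measurableE.
apply: (@lambda_system_subset _ _ _ setT) => //.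
- move=> _ _ [x ->] [y ->]; exists (Num.max x y).
  by apply/seteqP; split => z /=; rewrite !in_itv/= !andbT ge_max => /andP.
- split => //.
  + rewrite /H; have := approximable_exp_limit (exp_limit_cst 1); congr approximable.
    by apply/funext => x; rewrite indicT.
  + move=> A1 B BA HA HB; have := approximableB HA HB; rewrite /H; congr approximable.
    apply/funext => x; rewrite -mulrBr; congr (_ * _).
    rewrite !indicE in_setD; case: (boolP (x \in B)) => xB; last first.
      by rewrite andbT subr0.
    by rewrite andbF (_ : x \in A1) ?subrr// inE; apply: BA; rewrite inE in xB.
  + move=> F ndF HF; apply: (@approximable_cvg (fun n x =>
      r.[x] * \1_(F n) x) _ (fun x => `|r.[x]|)).
    * exact: HF.
    * move=> x; apply: cvgM; first exact: cvg_cst.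
      have [[n _ Fnx]|nF] := pselect ((\bigcup_i F i) x).
        apply: cvg_near_cst; exists n => // m /= nm.
        have Fmx : F m x by move: (ndF _ _ nm) => /subsetPset; apply.
        by rewrite !indicE !mem_set//; exists n.
      apply: cvg_near_cst; apply: nearW => n.
      by rewrite !indicE !memNset// => Fnx; apply: nF; exists n.
    * by move=> n x; rewrite normrM ler_piMr// indicE; case: (_ \in _);
        rewrite ?normr1 ?normr0.
    * exact: integrable_sqr_weight.
- by move=> _ [x ->]; exact: approximable_ge.
Qed.

Lemma approximable_sum I (s : seq I) (u_ : I -> T -> R) :
  (forall i, approximable (u_ i)) -> approximable (fun x => \sum_(i <- s) u_ i x).
Proof.
move=> au; elim: s => [|i s IH].
  have := approximable_poly 0; congr approximable; apply/funext => x.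
  by rewrite horner0 mulr0 big_nil.
have := approximableD (au i) IH; congr approximable; apply/funext => x.
by rewrite big_cons.
Qed.

Import HBNNSimple.

Lemma approximable_nnsfun (h : {nnsfun T >-> R}) : approximable (fun x =>
  r.[x] * h x).
Proof.
pose s := enum_fset (fset_set (range h)).
have hE x : h x = \sum_(y <- s) y * \1_(h @^-1` [set y]) x.
  by rewrite fimfunE fsbig_finite.
have := @approximable_sum _ s (fun y x => y * (r.[x] * \1_(h @^-1` [set y]) x)).
move=> /(_ _)/wrap[|]; first by move=> y; apply: approximableZ;
  exact: approximable_indic.
congr approximable; apply/funext => x.
by rewrite hE mulr_sumr; apply: eq_bigr => y _; rewrite mulrCA.
Qed.

Lemma approximable_ge0 g : measurable_fun [set: T] g -> (forall x, 0 <= g x) ->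
  mu.-integrable setT (fun x : T => ((r.[x] * g x) ^+ 2)%:E) ->
  approximable (fun x => r.[x] * g x).
Proof.
move=> mg g0 ig.
have mg' : measurable_fun [set: T] (EFin \o g) by exact/measurable_EFinP.
have gE x : (nnsfun_approx measurableT mg' n x)%:E @[n --> \oo] --> (g x)%:E.
  by apply: (cvg_nnsfun_approx measurableT mg') => // y _; rewrite lee_fin.
have hg n x : nnsfun_approx measurableT mg' n x <= g x.
  have nd : {homo (fun n => nnsfun_approx measurableT mg' n x) : m n
    / (m <= n)%N >-> m <= n}.
    by move=> m k mk; have /lefP := nd_nnsfun_approx measurableT mg' mk; exact.
  have gx : (fun n => nnsfun_approx measurableT mg' n x) @ \oo --> g x.
    exact: fine_cvg (gE x).
  have := nondecreasing_cvgn_le nd (cvgP _ gx) n.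
  by rewrite (cvg_lim _ gx).
apply: (@approximable_cvg (fun n x => r.[x] * nnsfun_approx measurableT mg' n x) _
   (fun x => `|r.[x] * g x|)).
- by move=> n; exact: approximable_nnsfun.
- move=> x; apply: cvgM; first exact: cvg_cst.
  exact: fine_cvg (gE x).
- by move=> n x; rewrite !normrM ler_wpM2l// !ger0_norm// ?fun_ge0.
- by apply: eq_integrable ig => // x _; rewrite real_normK ?num_real.
Qed.

Lemma poly_multiple_dense f : (forall x, r.[x] != 0) ->
  measurable_fun [set: T] f -> mu.-integrable setT (fun x : T => (f x ^+ 2)%:E) ->
  approximable f.
Proof.
move=> r0 mf fi.
pose g x := f x / r.[x].
have mg : measurable_fun [set: T] g.
  (* The power [-1] is the inverse on nonnegative bases only, hence the detour through [r ^+ 2]. *)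
  have -> : g = (fun x => f x * r.[x] * ((r ^+ 2).[x] `^ (-1))).
    apply/funext => x; rewrite powR_inv1 horner_exp ?sqr_ge0// /g.
    by rewrite -mulrA expr2 invfM mulVKf.
  apply: measurable_funM.
    by apply: measurable_funM => //; exact: measurable_horner.
  apply: (measurableT_comp (f := fun y : R => y `^ (-1)));
    last exact: measurable_horner.
  exact: measurable_powR.
have fg x : f x = r.[x] * g x by rewrite /g mulrC divfK.
have gi (h : T -> R) : measurable_fun [set: T] h -> (forall x, `|h x| <= `|g x|) ->
    mu.-integrable setT (fun x : T => ((r.[x] * h x) ^+ 2)%:E).
  move=> mh hg; apply: le_integrable fi => //.
    apply/measurable_EFinP/measurable_funX/measurable_funM => //.
    exact: measurable_horner.
  move=> x _ /=; rewrite lee_fin fg !normrX lerXn2r ?nnegrE//.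
  by rewrite normrM [leRHS]normrM ler_wpM2l//; exact: hg.
have mp : measurable_fun [set: T] (fun x =>
  Num.max (g x) 0) by apply: (@measurable_maxr _ _ _ _ g (fun=> 0)).
have mn : measurable_fun [set: T] (fun x => Num.max (- g x) 0).
  by apply: (@measurable_maxr _ _ _ _ (fun x => - g x) (fun=> 0)) => //;
    exact: measurable_funN.
have ap : approximable (fun x => r.[x] * Num.max (g x) 0).
  apply: approximable_ge0 => //; first by move=> x; rewrite le_max lexx orbT.
  apply: gi => // x; case: (leP (g x) 0) => [_|_//]; by rewrite normr0.
have an : approximable (fun x => r.[x] * Num.max (- g x) 0).
  apply: approximable_ge0 => //; first by move=> x; rewrite le_max lexx orbT.
  apply: gi => // x; case: (leP (- g x) 0) => [_|_]; by rewrite ?normr0 ?normrN.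
have := approximableB ap an; congr approximable; apply/funext => x.
rewrite fg -mulrBr; congr (_ * _); rewrite !maxEle oppr_le0.
by case: (lerP 0 (g x)) => [g0|g0]; case: (lerP (g x) 0) => [g1|g1]; lra.
Qed.

End PolynomialDensity.

(** * Integration against the weight as a density *)

Section OmegaIntegral.
Variables (R : realType) (F : {fset nat}).
Notation T := (measurableTypeR R).
Notation mu := (@lebesgue_measure R).
Notation omega := (@omegaF R F).
Local Open Scope classical_set_scope.
Local Open Scope ereal_scope.
Import HBNNSimple.

Lemma measurable_omegaFE : measurable_fun [set: T] (fun x : T => (omega x)%:E).
Proof. by apply/measurable_EFinP; exact: measurable_omegaF. Qed.

Lemma integral_omega_nnsfun (h : {nnsfun T >-> R}) :
  \int[omega_measure F]_x (h x)%:E = \int[mu]_x ((h x)%:E * (omega x)%:E).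
Proof.
have o0 x : 0 <= (omega x)%:E by rewrite lee_fin omegaF_ge0.
have mi y : measurable_fun [set: T] (fun x => (y * \1_(h @^-1` [set y]) x)%:E).
  by apply/measurable_EFinP/measurable_funM.
transitivity (\int[mu]_x (\sum_(y \in range h)
    (y * \1_(h @^-1` [set y]) x)%:E * (omega x)%:E)); last first.
  apply: eq_integral => x _; rewrite -ge0_mule_fsuml => [|y];
    last exact: nnfun_muleindic_ge0.
  by rewrite fsumEFin // -(fimfunE _ x).
rewrite ge0_integral_fsum//; last 2 first.
- by move=> y; apply: emeasurable_funM => //; exact: measurable_omegaFE.
- by move=> y x _; rewrite mule_ge0// nnfun_muleindic_ge0.
rewrite integralT_nnsfun sintegralE; apply: eq_fsbigr => y yh.
under [RHS]eq_integral do rewrite EFinM -muleA.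
have y0 : (0 <= y)%R by move: yh; rewrite inE => -[x _ <-].
rewrite ge0_integralZl//; last 2 first.
- by apply: emeasurable_funM; [exact/measurable_EFinP|exact: measurable_omegaFE].
- by move=> x _; rewrite mule_ge0// lee_fin indicE.
- congr (_ * _); rewrite -[LHS]/(\int[mu]_(x in h @^-1` [set y]) (omega x)%:E)
    [LHS]integral_mkcond.
  by apply: eq_integral => x _; rewrite epatch_indic muleC.
Qed.

(** By monotone convergence, both sides are limits of their values on simple functions increasing to
    [f]. *)
Lemma ge0_integral_omega (f : T -> \bar R) :
  measurable_fun [set: T] f -> (forall x, 0 <= f x) ->
  \int[omega_measure F]_x f x = \int[mu]_x (f x * (omega x)%:E).
Proof.
move=> mf f0; pose h := nnsfun_approx measurableT mf.
have hf x : (h n x)%:E @[n --> \oo] --> f x.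
  by apply: (cvg_nnsfun_approx measurableT mf).
have hmono x a b : (a <= b)%N -> (h a x <= h b x)%R.
  by move=> ab; exact/lefP/nd_nnsfun_approx.
have o0 x : 0 <= (omega x)%:E by rewrite lee_fin omegaF_ge0.
have mh n : measurable_fun [set: T] (EFin \o h n) by exact/measurable_EFinP.
have -> : \int[omega_measure F]_x f x =
    lim (\int[omega_measure F]_x (h n x)%:E @[n --> \oo]).
  have fE x : f x = lim ((h n x)%:E @[n --> \oo]) by apply/esym/cvg_lim.
  under eq_integral => x _ do rewrite fE.
  apply: monotone_convergence => //; first by move=> n x _; rewrite lee_fin.
  by move=> x _ a b ab; rewrite lee_fin; exact: hmono.
have fg x : f x * (omega x)%:E = lim ((h n x)%:E * (omega x)%:E @[n --> \oo]).
  by apply/esym/cvg_lim => //; apply: cvgeZr.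
under [RHS]eq_integral => x _ do rewrite fg.
rewrite (monotone_convergence mu) => //.
- by under eq_fun do rewrite integral_omega_nnsfun.
- by move=> n; apply: emeasurable_funM; [exact: mh|exact: measurable_omegaFE].
- by move=> n x _; rewrite mule_ge0// lee_fin.
- by move=> x _ a b ab; rewrite lee_wpmul2r// lee_fin; exact: hmono.
Qed.

Lemma integral_omega (f : T -> R) : measurable_fun [set: T] f ->
  \int[omega_measure F]_x (f x)%:E = \int[mu]_x (f x * omega x)%:E.
Proof.
move=> mf; have mf' : measurable_fun [set: T] (EFin \o f) by exact/measurable_EFinP.
rewrite integralE [RHS]integralE.
rewrite (ge0_integral_omega (measurable_funepos mf'))//.
rewrite (ge0_integral_omega (measurable_funeneg mf'))//.
congr (_ - _); apply: eq_integral => x _.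
  rewrite !funeposE /= -EFin_max -EFinM -EFin_max; congr EFin.
  by rewrite maxr_pMl ?omegaF_ge0// mul0r.
rewrite !funenegE /= -!EFin_max -EFinM; congr EFin.
by rewrite maxr_pMl ?omegaF_ge0// mul0r mulNr.
Qed.

Lemma integrable_omega (f : T -> R) : measurable_fun [set: T] f ->
  mu.-integrable setT (fun x => (f x * omega x)%:E) ->
  (omega_measure F).-integrable setT (fun x => (f x)%:E).
Proof.
move=> mf /integrableP[_ fo]; apply/integrableP; split; first exact/measurable_EFinP.
rewrite ge0_integral_omega//; last first.
  by apply: measurableT_comp => //; exact/measurable_EFinP.
apply: le_lt_trans fo; rewrite le_eqVlt; apply/orP; left; apply/eqP.
apply: eq_integral => x _.
by rewrite /= normrM (ger0_norm (omegaF_ge0 _ _)) EFinM.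
Qed.

End OmegaIntegral.

(** * Absence of real zeros *)

Section HalfLine.
Variable R : realType.
Notation T := (measurableTypeR R).
Notation mu := (@lebesgue_measure R).
Implicit Types (p q g : {poly R}) (a x : R).
Local Notation J a := (gintegral `[a, +oo[%classic).
Local Notation I := (gintegral [set: R]).

(** Makes the Gaussian measure the case of empty [F], so that the lemmas on [omega_measure] serve
    for [exp(-x^2)] as well. *)
Lemma omegaF0 x : omegaF fset0 x = gauss_fun x.
Proof.
rewrite /omegaF /OmegaF (_ : \det _ = 1) ?hornerC ?expr1n ?divr1//.
by move: (\matrix_(_, _) _); rewrite cardfs0 => A; rewrite det_mx00.
Qed.

(* The squared distance, in [L^2(exp(-x^2))], from [p] to the function equal
   to [q] on [[a, +oo[] and to [0] elsewhere. *)
Definition half_dist2 a q p : R :=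
  gintegral `]-oo, a[%classic (p ^+ 2) + J a ((q - p) ^+ 2).

Lemma half_dist2E a q p :
  half_dist2 a q p = J a (q ^+ 2) - 2 * J a (q * p) + I (p ^+ 2).
Proof.
have mJ : measurable `[a, +oo[%classic by exact: measurable_itv.
rewrite /half_dist2 (gintegralT a (p ^+ 2)) sqrrB gintegralD// gintegralB//.
by rewrite -scaler_nat gintegralZ//; ring.
Qed.

Lemma half_dist2_ge0 a q p : 0 <= half_dist2 a q p.
Proof. by rewrite addr_ge0// gintegral_sqr_ge0. Qed.

Lemma oner_horner_neq0 x : (1 : {poly R}).[x] != 0.
Proof. by rewrite hornerC oner_neq0. Qed.

(** The density theorem for the Gaussian measure with [r = 1], applied to the truncation of [q] at
    [a]; the squared distance is then split at [a]. *)
Lemma half_line_dense a q e : 0 < e -> exists p, half_dist2 a q p < e.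
Proof.
move=> e0.
have rexp (M : R) : (omega_measure fset0).-integrable setT
    (fun x : T => ((1 : {poly R}).[x] ^+ 2 * expR (M * `|x|))%:E).
  have mf : measurable_fun [set: T] (fun x : T =>
    (1 : {poly R}).[x] ^+ 2 * expR (M * `|x|)).
    apply: measurable_funM; first by apply: measurable_funX; exact: measurable_horner.
    by apply: measurableT_comp => //; apply: measurable_funM.
  apply: integrable_omega => //; apply: integrable_gauss_dominated => //.
    by apply: measurable_funM => //; exact: measurable_omegaF.
  exists 1, M => x; rewrite omegaF0 hornerC expr1n mul1r ger0_norm//.
  by rewrite mulr_ge0 ?expR_ge0 ?gauss_fun_ge0.
pose f (x : R) := if a <= x then q.[x] else 0.
have mf : measurable_fun [set: T] f.
  apply: measurable_fun_ifT => //; last exact: measurable_horner.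
  exact: measurable_fun_ler.
have f2 : (omega_measure fset0).-integrable setT (fun x : T => (f x ^+ 2)%:E).
  have [C C0 qC] := poly_le_expR (q ^+ 2).
  apply: le_integrable (integrableZl measurableT C (rexp 1)) => //.
    by apply/measurable_EFinP; exact: measurable_funX.
  move=> x _ /=; rewrite lee_fin hornerC expr1n !mul1r /f.
  rewrite (le_trans _ (ler_norm _))//; case: ifPn => _.
    by rewrite (le_trans _ (qC x))// horner_exp.
  by rewrite expr0n normr0 mulr_ge0 ?expR_ge0.
have [_ /(_ e e0) [p pe]] := poly_multiple_dense rexp
  oner_horner_neq0 mf f2.
exists p; move: pe; rewrite integral_omega; last first.
  by apply/measurable_funX/measurable_funB => //; apply: measurable_funM;
    exact: measurable_horner.
pose G x : \bar R := ((f x - (1 : {poly R}).[x] * p.[x]) ^+ 2 * omegaF fset0 x)%:E.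
have gE D q' : measurable D -> (forall x, D x -> G x = (q'.[x] * gauss_fun x)%:E) ->
    (\int[mu]_(x in D) G x = (gintegral D q')%:E)%E.
  move=> mD DG; rewrite /gintegral /Rintegral fineK; last first.
    by apply: integrable_fin_num => //; exact: integrable_horner_gauss.
  by apply: eq_integral => x /[!inE] Dx; exact: DG.
have TU : ([set: R] = `]-oo, a[ `|` `[a, +oo[)%classic.
  apply/seteqP; split => // x _ /=; rewrite !in_itv/= andbT.
  by have [|] := ltP x a; [left|right].
suff -> : (\int[mu]_x G x = (half_dist2 a q p)%:E)%E by rewrite lte_fin.
rewrite TU ge0_integral_setU//.
- rewrite (gE _ (p ^+ 2))//; last first.
    move=> x /=; rewrite in_itv/= => xa.
    by rewrite /G /f leNgt xa hornerC mul1r sub0r sqrrN omegaF0 horner_exp.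
  rewrite (gE _ ((q - p) ^+ 2))//.
  move=> x /=; rewrite in_itv/= andbT => ax.
  by rewrite /G /f ax hornerC mul1r omegaF0 horner_exp hornerD hornerN.
- rewrite -TU; apply/measurable_EFinP; apply: measurable_funM;
    last exact: measurable_omegaF.
  apply/measurable_funX/measurable_funB => //.
  by apply: measurable_funM; exact: measurable_horner.
- by move=> x _; rewrite lee_fin mulr_ge0 ?sqr_ge0 ?omegaF_ge0.
- rewrite disj_set2E; apply/eqP; rewrite -subset0 => y [] /=.
  by rewrite !in_itv/= andbT => /lt_le_trans /[apply]; rewrite ltxx.
Qed.

Local Notation h n := (I (hermite R n * hermite R n)).

(** Orthogonality, then completing the square in each [b n]. The Fourier coefficients are the
    minimizers, which yields both Bessel and Parseval. *)
Lemma half_dist2_hermite a q N (b : nat -> R) :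
  half_dist2 a q (\sum_(n < N) b n *: hermite R n) =
  J a (q ^+ 2) - \sum_(n < N) J a (q * hermite R n) ^+ 2 / h n +
  \sum_(n < N) h n * (b n - J a (q * hermite R n) / h n) ^+ 2.
Proof.
have mJ : measurable `[a, +oo[%classic by exact: measurable_itv.
rewrite half_dist2E mulr_sumr gintegral_sum//
  [(\sum_(_ < _) _) ^+ 2]expr2 mulr_suml gintegral_sum//.
rewrite -!addrA; congr (_ + _); rewrite -!sumrN mulr_sumr -sumrN -!big_split /=.
apply: eq_bigr => n _; rewrite mulr_sumr gintegral_sum// (bigD1 n)//= big1 => [|m mn].
  have hn : h n != 0 by rewrite gt_eqF// hermite_norm_gt0.
  rewrite gintegralZr// gintegralZl// gintegralZr// addr0; field.
  exact: hn.
rewrite gintegralZr// gintegralZl// hermite_orthogonal ?mulr0// eq_sym.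
by move: mn; apply: contraNneq => /val_inj ->.
Qed.

Lemma bessel a q N :
  \sum_(n < N) J a (q * hermite R n) ^+ 2 / h n <= J a (q ^+ 2).
Proof.
have := half_dist2_ge0 a q
  (\sum_(n < N) (J a (q * hermite R n) / h n) *: hermite R n).
rewrite (half_dist2_hermite a q N (fun n => J a (q * hermite R n) / h n)).
rewrite [X in _ + X]big1 => [|n _].
  by rewrite addr0 subr_ge0.
by rewrite subrr expr0n mulr0.
Qed.

(** A close polynomial [p] lies in the span of the first [size p] Hermite polynomials, where the
    Fourier sum is at least as good; further terms only increase the sum of squares. *)
Lemma parseval a q e : 0 < e -> exists N0, forall N, (N0 <= N)%N ->
  J a (q ^+ 2) < \sum_(n < N) J a (q * hermite R n) ^+ 2 / h n + e.
Proof.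
move=> e0; have [p pe] := half_line_dense a q e0.
have [b pb] := hermite_span p; exists (size p) => N pN.
move: pe; rewrite pb half_dist2_hermite => pe.
have t0 n : 0 <= J a (q * hermite R n) ^+ 2 / h n.
  by rewrite divr_ge0 ?sqr_ge0// ltW// hermite_norm_gt0.
apply: (@lt_le_trans _ _ (\sum_(n < size p) J a (q * hermite R n) ^+ 2 / h n + e)).
  rewrite -ltrBlDl; apply: le_lt_trans pe; rewrite lerDl sumr_ge0// => n _.
  by rewrite mulr_ge0 ?sqr_ge0// ltW// hermite_norm_gt0.
rewrite lerD2r -(big_mkord xpredT (fun n => J a (q * hermite R n) ^+ 2 / h n)).
rewrite -(big_mkord xpredT (fun n => J a (q * hermite R n) ^+ 2 / h n)).
by rewrite [leRHS](big_cat_nat (n := size p))//= lerDl sumr_ge0.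
Qed.

(* A combination of [hermite f], [f \in s], is annihilated by the product of
   the [A - f], whose symbol is nonnegative on [nat] by hypothesis: if it
   vanishes to the order [size s] at [a], then its truncation at [a] has no
   Hermite coefficients outside [s], so it is a polynomial almost everywhere. *)
Lemma vanish_hermite_eq0 (s : seq nat) l g a :
  size s = l.*2 -> (forall n : nat, 0 <= \prod_(f <- s) (n%:R - f%:R : R)) ->
  hops s g = 0 -> vanish (size s) g a -> g = 0.
Proof.
move=> sl s0 gs ga.
pose s1 := take l s; pose s2 := drop l s.
have sz1 : size s1 = l by rewrite size_takel// sl -addnn leq_addl.
have sz2 : size s2 = l by rewrite size_drop sl -addnn addnK.
have mJ : measurable `[a, +oo[%classic by exact: measurable_itv.
pose A n := J a (g * hermite R n).
pose P (s : seq nat) (n : nat) : R := \prod_(f <- s) (n%:R - f%:R).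
have PE n : P s n = P s1 n * P s2 n by rewrite /P -{1}(cat_take_drop l s) big_cat.
have g1E n : J a (hops s1 g * hermite R n) = P s1 n * A n.
  by rewrite -gintegral_hops ?sz1 -?sl// hops_hermite gintegralZr.
have g2E n : J a (hops s2 g * hermite R n) = P s2 n * A n.
  by rewrite -gintegral_hops ?sz2 -?sl// hops_hermite gintegralZr.
have g12 : J a (hops s1 g * hops s2 g) = 0.
  rewrite -gintegral_hops ?sz1 -?sl// -hops_cat cat_take_drop gs mulr0.
  exact: gintegral0.
(* By [g12] the truncations of [hops s1 g] and [hops s2 g] are orthogonal, so their sum and
   difference have the same norm. Bessel for the sum against Parseval for the difference bounds the
   sum of the nonnegative terms [4 * P s m * A m ^+ 2 / h m] by [e]. *)
have small e n : 0 < e -> 4 * P s n * A n ^+ 2 / h n < e.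
  move=> e0; have [N0 HN0] := parseval a (hops s1 g - hops s2 g) e0.
  pose N := maxn N0 n.+1; have := HN0 N (leq_maxl _ _).
  have := bessel a (hops s1 g + hops s2 g) N.
  have -> : J a ((hops s1 g + hops s2 g) ^+ 2) = J a ((hops s1 g - hops s2 g) ^+ 2).
    have -> : (hops s1 g + hops s2 g) ^+ 2 =
      (hops s1 g - hops s2 g) ^+ 2 + 4 *: (hops s1 g * hops s2 g).
      by rewrite -mul_polyC polyCMn; ring.
    by rewrite gintegralD// gintegralZ// g12 mulr0 addr0.
  move=> /le_lt_trans /[apply]; rewrite -ltrBlDl -sumrB; apply: le_lt_trans.
  under eq_bigr => m _.
    rewrite mulrDl mulrBl gintegralD// gintegralB// g1E g2E.
    have -> : (P s1 m * A m + P s2 m * A m) ^+ 2 / h m -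
      (P s1 m * A m - P s2 m * A m) ^+ 2 / h m = 4 * P s m * A m ^+ 2 / h m.
      by rewrite PE; ring.
    over.
  have nN : (n < N)%N by rewrite leq_maxr.
  rewrite (bigD1 (Ordinal nN))//= lerDl sumr_ge0// => m _.
  rewrite divr_ge0 ?(ltW (hermite_norm_gt0 _ _))// mulr_ge0 ?sqr_ge0// mulr_ge0//.
  exact: s0.
have A0 n : n \notin s -> A n = 0.
  move=> ns; apply/eqP; apply/negPn/negP => An.
  have Pn : 0 < P s n.
    rewrite lt_neqAle s0 andbT eq_sym prodf_seq_neq0; apply/allP => f fs.
    by rewrite /= subr_eq0 eqr_nat; apply: contraNneq ns => ->.
  have t0 : 0 < 4 * P s n * A n ^+ 2 / h n.
    rewrite divr_gt0 ?hermite_norm_gt0//; apply: mulr_gt0; first exact: mulr_gt0.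
    by rewrite lt_neqAle sqr_ge0 eq_sym sqrf_eq0 An.
  by have := small _ n t0; rewrite ltxx.
(* Past every element of [s], so that the Fourier sum [p] contains all nonzero coefficients. *)
pose N := (\max_(f <- s) f).+1.
pose p := \sum_(n < N) (A n / h n) *: hermite R n.
have d0 : half_dist2 a g p = 0.
  apply/eqP; rewrite eq_le half_dist2_ge0 andbT; apply/ler_addgt0Pl => e e0.
  rewrite addr0 (half_dist2_hermite a g N (fun n =>
    A n / h n)) [X in _ + X]big1 => [|n _]; last first.
    by rewrite subrr expr0n mulr0.
  have [N0 HN0] := parseval a g e0.
  have := HN0 _ (leq_maxr N N0); rewrite addr0 -ltrBlDl => /ltW.
  apply: le_trans; rewrite lerB//.
  rewrite -(big_mkord xpredT (fun n => J a (g * hermite R n) ^+ 2 / h n)).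
  rewrite -(big_mkord xpredT (fun n => J a (g * hermite R n) ^+ 2 / h n)).
  rewrite [leLHS](big_cat_nat (n := N))//= ?leq_maxl// gerDl big_nat big1// =>
    n /andP[Nn _].
  have ns : n \notin s.
    apply/negP => ns; move: Nn; rewrite /N ltnNge => /negP; apply.
    exact: (@leq_bigmax_seq _ s xpredT id).
  by rewrite -/(A n) A0// expr0n mul0r.
move/eqP: d0; rewrite paddr_eq0 ?gintegral_sqr_ge0// => /andP[/eqP pl /eqP pr].
(* At distance zero, [p] agrees with [0] to the left of [a], hence is zero, and with [g] to the
   right. *)
have p0 : p = 0.
  apply: (gintegral_sqr_eq0 (a := a - 2) (b := a - 1)) pl.
  - by rewrite ltrD2l ltrN2 ltr1n.
  - exact: measurable_itv.
  - by move=> x /=; rewrite !in_itv/= => /andP[_ /le_lt_trans]; apply; rewrite gtrBl.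
have : g - p = 0.
  apply: (gintegral_sqr_eq0 (a := a) (b := a + 1)) pr => //.
  - by rewrite ltrDl.
  - by move=> x /=; rewrite !in_itv/= andbT => /andP[].
by rewrite p0 subr0.
Qed.

End HalfLine.

(** * Nonnegativity of the symbol of an admissible set *)

Section Admissible.
Variable R : realType.
Implicit Types (s : seq nat) (A B F : {fset nat}).

(** Evenness of the length is carried along because the list of factors is later cut at its
    middle. *)
Definition nonneg_symbol s :=
  ~~ odd (size s) /\ forall n : nat, 0 <= \prod_(f <- s) (n%:R - f%:R : R).

Lemma nonneg_symbol_cat s1 s2 :
  nonneg_symbol s1 -> nonneg_symbol s2 -> nonneg_symbol (s1 ++ s2).
Proof.
move=> [e1 p1] [e2 p2]; split=> [|n]; last by rewrite big_cat mulr_ge0.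
by rewrite size_cat oddD (negbTE e1) (negbTE e2).
Qed.

Lemma nonneg_symbol_perm s1 s2 :
  perm_eq s1 s2 -> nonneg_symbol s1 -> nonneg_symbol s2.
Proof.
move=> s12 [e1 p1]; split=> [|n]; first by rewrite -(perm_size s12).
by rewrite -(perm_big _ s12).
Qed.

(** Pair [a] with [a + 1]: no integer lies strictly between them, so [(n - a) (n - a - 1) >= 0]. *)
Lemma nonneg_symbol_iota a m : ~~ odd m -> nonneg_symbol (iota a m).
Proof.
move=> em; rewrite -(odd_double_half m) (negbTE em) add0n.
elim: m./2 a => [|j IH] a; first by split=> // n; rewrite big_nil.
rewrite doubleS -[_.+2]/(2 + _)%N iotaD; apply: nonneg_symbol_cat (IH _).
split=> // n; rewrite !big_cons big_nil mulr1 -natr1.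
have [na|an] := leqP n a.
  have : (n%:R <= a%:R :> R) by rewrite ler_nat.
  by move=> na'; rewrite mulr_le0// ?subr_le0// ler_wpDr.
have : (a.+1%:R <= n%:R :> R) by rewrite ler_nat.
by rewrite -natr1 => an'; rewrite mulr_ge0// ?subr_ge0// (le_trans _ an')// lerDl.
Qed.

Lemma perm_fsetU_disjoint A B : [disjoint A & B]%fset ->
  perm_eq (enum_fset A ++ enum_fset B) (enum_fset (A `|` B)%fset).
Proof.
move=> /fdisjointP dAB; apply: uniq_perm.
- rewrite cat_uniq !fset_uniq andbT /=; apply/hasPn => x xB.
  by apply/negP => xA; move: (dAB x xA); rewrite xB.
- exact: fset_uniq.
- by move=> x; rewrite mem_cat in_fsetU.
Qed.

Lemma admissible_symbol F : admissible F -> nonneg_symbol (felems F).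
Proof.
move=> [K [Y [[-> dY cY _] eY]]].
apply: (@nonneg_symbol_perm (enum_fset (\big[fsetU/fset0]_(i < K) Y i))).
  by rewrite perm_sym perm_sort.
elim: K dY cY eY => [|K IH] dY cY eY.
  by rewrite big_ord0; split=> // n; rewrite big_seq_fset0 ?big_nil.
rewrite big_ord_recr /=; apply: nonneg_symbol_perm (perm_fsetU_disjoint _) _.
  apply/fdisjointP => x /bigfcupP [i _ xi].
  have iK : (i < K < K.+1)%N by rewrite ltn_ord ltnSn.
  by have /fdisjointP := dY i K iK; apply.
apply: nonneg_symbol_cat.
  apply: IH => [i j /andP[ij jK]|i iK|i iK].
  - by apply: dY; rewrite ij ltnS ltnW.
  - by apply: cY; rewrite ltnS ltnW.
  - by apply: eY; rewrite ltnS ltnW.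
have [a [l Ye]] := cY K (ltnSn K); have := eY K (ltnSn K).
have pY : perm_eq (iota a l.+1) (enum_fset (Y K)).
  apply: uniq_perm; [exact: iota_uniq|exact: fset_uniq|].
  move=> x; rewrite Ye; apply/idP/imfsetP => [xi|[y yi ->]]; last exact: yi.
  by exists x.
rewrite -(perm_size pY) => e.
by apply: nonneg_symbol_perm pY _; apply: nonneg_symbol_iota; rewrite size_iota in e.
Qed.

End Admissible.

(** * Wronskians *)

Section BorderedDeterminant.
Variable S : comNzRingType.

(** In the expansion along the first row, the combination of the other rows meets the cofactors of
    the wrong row and contributes zero; only the corner entry [t] remains. *)
Lemma det_bordered k (B : 'M[S]_k.+1) (c : 'I_k -> S) (d t : S) :
  (forall j, d * B ord0 j =
    \sum_i c i * B (lift ord0 i) j + t *+ (j == ord_max)) ->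
  d * \det B = (-1) ^+ k * t * \det (row' ord0 (col' ord_max B)).
Proof.
move=> Bc; rewrite (expand_det_row B ord0) mulr_sumr.
under eq_bigr do rewrite mulrA Bc mulrDl.
rewrite big_split /= [X in X + _](_ : _ = 0) ?add0r; last first.
  under eq_bigr do rewrite mulr_suml.
  rewrite exchange_big big1//= => i _.
  under eq_bigr do rewrite -mulrA; rewrite -mulr_sumr.
  have := mul_mx_adj B => /matrixP/(_ (lift ord0 i) ord0).
  rewrite !mxE /= mulr0n; under eq_bigr do rewrite mxE.
  by move=> ->; rewrite mulr0.
rewrite (bigD1 ord_max)//= big1 ?addr0 => [|j jm]; last first.
  by rewrite (negbTE jm) mulr0n mul0r.
by rewrite eqxx mulr1n /cofactor add0n mulrCA mulrA.
Qed.

End BorderedDeterminant.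

Section Wronskian.
Variable R : realType.
Implicit Types (p q : {poly R}) (h : nat -> {poly R}) (x : R).

Definition wronskian_mx k h : 'M[{poly R}]_k := \matrix_(i, j) (h i)^`(j).

Definition wronskian k h : {poly R} := \det (wronskian_mx k h).

Definition pcons p h i := if i is j.+1 then h j else p.

Lemma wronskian_bordered k h p (c : 'I_k -> {poly R}) (d t : {poly R}) :
  (forall j : nat, (j < k)%N -> d * p^`(j) = \sum_i c i * (h i)^`(j)) ->
  d * p^`(k) = \sum_i c i * (h i)^`(k) + t ->
  d * wronskian k.+1 (pcons p h) = (-1) ^+ k * t * wronskian k h.
Proof.
move=> cj ck; rewrite /wronskian (@det_bordered _ k _ c d t) => [|j].
  congr (_ * \det _); apply/matrixP => i j; rewrite !mxE /=.
  by rewrite /bump leqNgt ltn_ord.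
rewrite mxE /=; under eq_bigr do rewrite mxE /=.
have [->|jm] := eqVneq j ord_max; first by rewrite ck.
rewrite addr0; apply: cj.
by rewrite ltn_neqAle -ltnS ltn_ord andbT.
Qed.

Section Cramer.
Variables (k : nat) (h : nat -> {poly R}).
Local Notation W := (wronskian_mx k.+1 h).
Local Notation Om := (wronskian k.+1 h).
Hypothesis Om0 : Om != 0.

(** Cramer's rule without division: the [cramer p i / Om] are the coefficients of the combination of
    the [h i] that matches [p] in all derivatives up to the order [k]. *)
Definition cramer p (i : 'I_k.+1) : {poly R} :=
  \sum_(j < k.+1) p^`(j) * \adj W j i.

(** The error of that combination in the next derivative, times [Om]; up to sign it is the Wronskian
    of [p] and the [h i]. *)
Definition residual p : {poly R} :=
  Om * p^`(k.+1) - \sum_i cramer p i * (h i)^`(k.+1).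

Lemma cramerE p (j : nat) : (j < k.+1)%N ->
  \sum_i cramer p i * (h i)^`(j) = Om * p^`(j).
Proof.
move=> jk; pose b : 'rV[{poly R}]_k.+1 := \row_j p^`(j).
have := congr1 (fun M => (b *m M) ord0 (Ordinal jk)) (mul_adj_mx W).
rewrite mulmxA mul_mx_scalar mxE /= => e;
  rewrite [RHS](_ : _ = Om * b ord0 (Ordinal jk)); last first.
  by rewrite mxE.
move: e; rewrite !mxE => <-.
apply: eq_bigr => i _; congr (_ * _); last by rewrite mxE.
by rewrite mxE; apply: eq_bigr => m _; rewrite [b _ _]mxE.
Qed.

(** The last row of [\adj W *m W = Om%:M]. At a fixed point this row of the adjugate combines the
    [h i] into a polynomial vanishing there to the order [k]. *)
Lemma adj_lastE (j : nat) : (j < k.+1)%N ->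
  \sum_i \adj W ord_max i * (h i)^`(j) = Om *+ (j == k).
Proof.
move=> jk; have := congr1 (fun M : 'M[{poly R}]_k.+1 =>
  M ord_max (Ordinal jk)) (mul_adj_mx W).
rewrite !mxE => e; rewrite -[j == k]/(Ordinal jk == ord_max) eq_sym -e.
by apply: eq_bigr => i _; rewrite [W _ _]mxE.
Qed.

Lemma wronskian_row_inj (u v : 'I_k.+1 -> {poly R}) :
  (forall j : nat, (j < k.+1)%N ->
    \sum_i u i * (h i)^`(j) = \sum_i v i * (h i)^`(j)) -> u =1 v.
Proof.
move=> uv i; pose U : 'rV[{poly R}]_k.+1 := \row_i u i.
pose V : 'rV[{poly R}]_k.+1 := \row_i v i.
have UV : U *m W = V *m W.
  apply/matrixP => a j; rewrite !mxE; have := uv j (ltn_ord j).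
  move=> e; transitivity (\sum_i u i * (h i)^`(j)).
    by apply: eq_bigr => m _; rewrite !mxE.
  by rewrite e; apply: eq_bigr => m _; rewrite !mxE.
have := congr1 (fun M : 'rV[{poly R}]_k.+1 => (M *m \adj W) ord0 i) UV.
rewrite -!mulmxA mul_mx_adj !mul_mx_scalar !mxE.
exact: mulfI.
Qed.

Lemma wronskian_residual p :
  wronskian k.+2 (pcons p h) = (-1) ^+ k.+1 * residual p.
Proof.
apply: (mulfI Om0).
rewrite (@wronskian_bordered _ _ _ (cramer p) Om (residual p)).
- by rewrite mulrC.
- by move=> j jk; rewrite cramerE.
- by rewrite /residual addrCA subrr addr0.
Qed.

(** The left side is [Om ^+ 2] times the derivative of [cramer p i / Om]. Differentiating [cramerE]
    gives linear equations for it whose right sides vanish except the last, where [residual p]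
    appears; the last row of the adjugate solves the same system. *)
Lemma cramer_deriv p i :
  Om * (cramer p i)^`() - Om^`() * cramer p i = residual p * \adj W ord_max i.
Proof.
move: i; apply: wronskian_row_inj => j jk.
under eq_bigr do rewrite mulrBl -!mulrA.
rewrite sumrB -!mulr_sumr cramerE// .
under [in RHS]eq_bigr do rewrite -mulrA.
rewrite -mulr_sumr adj_lastE//.
have := congr1 (fun q : {poly R} => q^`()) (cramerE p jk).
rewrite raddf_sum /= derivM -derivnS.
under eq_bigr do rewrite derivM -derivnS.
rewrite big_split => /(canRL (addrK _)) ->.
have [->|jk'] := eqVneq j k; first by rewrite mulr1n /residual; ring.
rewrite cramerE; last by rewrite ltnS ltn_neqAle jk' -ltnS.
by rewrite mulr0; ring.
Qed.

End Cramer.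

Lemma horner_wronskian k h x :
  (wronskian k h).[x] = \det (\matrix_(i < k, j < k) (h i)^`(j).[x]).
Proof.
rewrite /wronskian -horner_evalE -det_map_mx; congr (\det _).
by apply/matrixP => i j; rewrite !mxE.
Qed.

End Wronskian.

(** * Nonvanishing of the Hermite Wronskian *)

Section HermiteWronskian.
Variables (R : realType) (s : seq nat) (l : nat).
Hypotheses (sl : size s = l.*2) (us : uniq s) (sym : nonneg_symbol R s).
Local Notation h := (fun i => hermite R (nth 0%N s i)).
Local Notation J a := (gintegral `[a, +oo[%classic).
Local Notation I := (gintegral [set: R]).

Lemma hops_comb k (c : 'I_k -> R) : (k <= size s)%N ->
  hops s (\sum_(i < k) c i *: h i) = 0.
Proof.
move=> ks; rewrite hops_sum big1// => i _.
by rewrite hopsZ hops_hermite0 ?scaler0// mem_nth// (leq_trans (ltn_ord i)).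
Qed.

Lemma derivn_comb k (c : 'I_k -> R) (g : nat -> {poly R}) (j : nat) x :
  (\sum_(i < k) c i *: g i)^`(j).[x] = \sum_(i < k) c i * (g i)^`(j).[x].
Proof.
rewrite raddf_sum horner_sum; apply: eq_bigr => i _.
by rewrite /= derivnZ hornerZ.
Qed.

Lemma hermite_wronskian_neq0 x : (wronskian (size s) h).[x] != 0.
Proof.
rewrite horner_wronskian; apply/det0P => -[v v0 vW].
pose g := \sum_(i < size s) v ord0 i *: h i.
have g0 : g = 0.
  apply: (vanish_hermite_eq0 sl _ (hops_comb _ (leqnn _)) (a := x)).
    by case: sym.
  move=> j js; rewrite (derivn_comb (fun i => v ord0 i) h).
  move/matrixP: vW => /(_ ord0 (Ordinal js)); rewrite !mxE => e.
  by rewrite -[RHS]e; apply: eq_bigr => i _; rewrite mxE.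
case/eqP: v0; apply/matrixP => a i; rewrite ord1 mxE.
(* Pairing with [h i] isolates the coefficient of index [i], as the entries of [s] are distinct. *)
have : I (g * h i) = 0 by rewrite g0 mul0r gintegral0.
rewrite /g mulr_suml gintegral_sum// (bigD1 i)//= big1 => [|m mi].
  rewrite gintegralZl// addr0 => /eqP; rewrite mulf_eq0 => /orP[/eqP//|].
  by rewrite gt_eqF// hermite_norm_gt0.
rewrite gintegralZl// hermite_orthogonal ?mulr0// nth_uniq//.
Qed.

End HermiteWronskian.

(** * Products of residuals through half-line integrals *)

Section HermiteResidual.
Variables (R : realType) (s : seq nat) (l : nat).
Hypotheses (sl : size s = l.+1.*2) (us : uniq s) (sym : nonneg_symbol R s).
Local Notation h := (fun i => hermite R (nth 0%N s i)).
Local Notation J a := (gintegral `[a, +oo[%classic).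
Local Notation I := (gintegral [set: R]).
Local Notation k := (l.*2.+1).
Local Notation Om := (wronskian k.+1 h).
Local Notation E i := (\adj (wronskian_mx k.+1 h) ord_max i).

Lemma Om_horner_neq0 x : Om.[x] != 0.
Proof. by have := hermite_wronskian_neq0 sl us sym x; rewrite sl. Qed.

Lemma Om_neq0 : Om != 0.
Proof. by apply: contraNneq (Om_horner_neq0 0) => ->; rewrite horner0. Qed.

(** Closed form, from Green's identity, of the half-line integral of [h i * hermite R n] divided by
    the Gaussian, for [n] outside [s]. *)
Definition halfline_poly n (i : 'I_k.+1) : {poly R} :=
  (2 * (n%:R - (nth 0%N s i)%:R))^-1 *:
    (h i * (hermite R n)^`() - (h i)^`() * hermite R n).

Lemma nth_diff_neq0 n (i : 'I_k.+1) : n \notin s -> n%:R - (nth 0%N s i)%:R != 0 :> R.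
Proof.
move=> ns; rewrite subr_eq0 eqr_nat; apply: contraNneq ns => ->.
by rewrite mem_nth// sl ltn_ord.
Qed.

Lemma gintegral_halfline (n : nat) (i : 'I_k.+1) a : n \notin s ->
  J a (h i * hermite R n) = (halfline_poly n i).[a] * gauss_fun a.
Proof.
move=> ns; have d0 := nth_diff_neq0 i ns.
have := gintegral_green (nth 0%N s i) (h i) (hermite R n) a.
rewrite /hshift !hermite_eigen subrr mul0r gintegral0 ?subr0//
  -scalerBl gintegralZr// => e.
apply: (mulfI d0); rewrite e /halfline_poly hornerZ.
by field.
Qed.

Lemma halfline_poly_deriv (n : nat) (i : 'I_k.+1) : n \notin s ->
  (halfline_poly n i)^`() - 2 *: 'X * halfline_poly n i = - (h i * hermite R n).
Proof.
move=> ns; have d0 := nth_diff_neq0 i ns.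
have := hshift_green (nth 0%N s i) (h i) (hermite R n).
rewrite /hshift !hermite_eigen subrr mul0r subr0 -scalerBl -scalerAr => e.
rewrite /halfline_poly derivZ -[2 *: 'X * (_ *: _)]scalerAr -scalerBr.
have -> : (2 * (n%:R - (nth 0%N s i)%:R))^-1 =
   - (n%:R - (nth 0%N s i)%:R)^-1 * (- 2^-1) :> R by field.
by rewrite -scalerA -e scalerA mulNr mulVf// scaleN1r.
Qed.

Local Notation symbol n := (\prod_(f <- s) (n%:R - f%:R) : R).

(** The integral of [e * hops s g] over [[x, +oo[] is computed twice. The coefficients of [e] are
    the last row of the adjugate, and [g] is the Cramer error of [hermite R n]. As [hops s] kills
    the [h i], the integral is the left side times [Om.[x] * gauss_fun x]; the surviving boundary
    term is the right side times the same factor. *)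
Lemma adj_halfline (n : nat) x : n \notin s ->
  symbol n * \sum_i (E i).[x] * (halfline_poly n i).[x] =
  2^-1 ^+ k.+1 * (residual k h (hermite R n)).[x].
Proof.
move=> ns.
pose e := \sum_(i < k.+1) (E i).[x] *: h i.
pose c (i : 'I_k.+1) := (cramer h (hermite R n) i).[x].
pose g := Om.[x] *: hermite R n - \sum_(i < k.+1) c i *: h i.
have ej j : (j < k.+1)%N -> e^`(j).[x] = Om.[x] *+ (j == k).
  move=> jk; rewrite (derivn_comb (fun i => (E i).[x]) h) -hornerMn -adj_lastE//.
  by rewrite horner_sum; apply: eq_bigr => i _; rewrite hornerM.
have gE j : g^`(j).[x] =
    (Om * (hermite R n)^`(j) - \sum_(i < k.+1) cramer h (hermite R n) i * (h
      i)^`(j)).[x].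
  rewrite /g derivnB hornerD !hornerN derivnZ hornerZ (derivn_comb c h) hornerD
    hornerM hornerN.
  congr (_ - _); rewrite horner_sum.
  apply: eq_bigr => i _.
  by rewrite hornerM.
have g0 j : (j < k.+1)%N -> g^`(j).[x] = 0.
  by move=> jk; rewrite gE cramerE// subrr horner0.
have gk : g^`(k.+1).[x] = (residual k h (hermite R n)).[x] by rewrite gE.
(* The lengths [l], [1], [l + 1] match the orders [2l + 1] and [2l + 2] to which [e] and [g] vanish
   at [x]. *)
pose s1 := take l s; pose f := nth 0%N s l; pose s2 := drop l.+1 s.
have lk : (l < size s)%N by rewrite sl; lia.
have sE : s = s1 ++ f :: s2 by rewrite /s1 /f /s2 -drop_nth// cat_take_drop.
have z1 : size s1 = l by rewrite size_take lk.
have z2 : size s2 = l.+1 by rewrite size_drop sl; lia.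
have he : hops s e = 0 by apply: hops_comb; rewrite sl.
have hg : hops s g = Om.[x] *: (symbol n *: hermite R n).
  rewrite /g hopsD hopsZ hops_hermite -[- \sum_(_ < _) _]scaleN1r hopsZ.
  by rewrite (hops_comb c) ?sl// scaler0 addr0.
have mJ : measurable `[x, +oo[%classic by exact: measurable_itv.
have JE : J x (e * hops s g) =
    Om.[x] * symbol n * (\sum_i (E i).[x] * (halfline_poly n i).[x]) * gauss_fun x.
  rewrite hg gintegralZr// gintegralZr// mulrA -[RHS]mulrA; congr (_ * _).
  rewrite !mulr_suml gintegral_sum//; apply: eq_bigr => i _.
  by rewrite gintegralZl// gintegral_halfline// mulrA.
have := @gintegral_hops_boundary R s1 f s2 e g x.
rewrite -sE JE z1 z2 => /(_ erefl _ _ he) b.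
apply: (mulIf (x := Om.[x] * gauss_fun x)).
  by rewrite mulf_neq0 ?Om_horner_neq0// gt_eqF// expR_gt0.
have -> : forall (a b c d : R), a * b * (c * d) = c * a * b * d by move=> *; ring.
rewrite b ?ej ?gk//.
- have -> : - 2^-1 * (- 2^-1) ^+ (l + l.+1) = 2^-1 ^+ l.*2.+2 :> R.
    by rewrite -exprS addnS addnn exprNn -signr_odd /= odd_double expr0 mul1r.
  by rewrite eqxx mulr1n; ring.
- by move=> j jl; rewrite ej ?ltn_eqF ?mulr0n// ltnS ltnW.
Qed.

(** After division by [Om ^+ 2], the first term in the parentheses is [(B w / Om)' / w].
    [cramer_deriv] and [halfline_poly_deriv] compute it, and [adj_halfline] turns the sum that
    appears into the residual of [hermite R n]. *)
Lemma cramer_halfline (m n : nat) x : n \notin s ->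
  let B := \sum_(i < k.+1) cramer h (hermite R m) i * halfline_poly n i in
  let T p := (residual k h p).[x] in
  T (hermite R m) * T (hermite R n) = 2 ^+ k.+1 * symbol n *
    ((B^`() * Om - B * Om^`() - 2 *: 'X * B * Om).[x] +
      (Om ^+ 2 * (hermite R m * hermite R n)).[x]).
Proof.
move=> ns B T; have := adj_halfline x ns => /(congr1 (fun z => 2 ^+ k.+1 * z)).
rewrite mulrA exprVn mulVKf ?expf_neq0 ?pnatr_eq0// => TE.
rewrite {2}/T -TE mulrCA; congr (_ * _).
have -> : B^`() * Om - B * Om^`() - 2 *: 'X * B * Om =
  residual k h (hermite R m) * \sum_i E i * halfline_poly n i -
  Om ^+ 2 * (hermite R m * hermite R n).
  have -> : Om ^+ 2 * (hermite R m * hermite R n) =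
      Om * (\sum_(i < k.+1) cramer h (hermite R m) i * (h i)^`(0)) * hermite R n.
    by rewrite cramerE//= expr2 !mulrA.
  pose NQ i := cramer h (hermite R m) i * halfline_poly n i.
  transitivity (\sum_(i < k.+1)
      ((NQ i)^`() * Om - NQ i * Om^`() - 2 *: 'X * NQ i * Om)).
    by rewrite !sumrB -!mulr_suml -mulr_sumr /B raddf_sum.
  rewrite mulr_sumr [X in _ = _ - X * _]mulr_sumr mulr_suml -sumrB.
  apply: eq_bigr => i _; rewrite /NQ.
  rewrite !mulrA -cramer_deriv ?Om_neq0// derivM.
  have /eqP := halfline_poly_deriv i ns; rewrite subr_eq => /eqP ->.
  by rewrite /=; ring.
rewrite hornerD hornerN subrK hornerM -/(T _); congr (_ * _).
by rewrite horner_sum; apply: eq_bigr => i _; rewrite hornerM.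
Qed.

End HermiteResidual.

(** * Quotients by a polynomial without real zeros *)

Section NonvanishingPolynomial.
Variable R : realType.
Implicit Types (p q : {poly R}) (x : R).
Notation mu := (@lebesgue_measure R).

Lemma poly_lower_bound p : p != 0 ->
  exists M c : R, 0 < c /\ forall x, M <= `|x| -> c <= `|p.[x]|.
Proof.
elim/poly_ind: p => [|q c IH]; first by rewrite eqxx.
have [-> |q0 _] := eqVneq q 0.
  rewrite mul0r add0r polyC_eq0 => c0; exists 0, `|c|; split;
    first by rewrite normr_gt0.
  by move=> x _; rewrite hornerC.
have [M [d [d0 Mq]]] := IH q0.
exists (Num.max M (1 + `|c| / d)), d; split=> // x; rewrite ge_max => /andP[Mx cx].
rewrite hornerMXaddC -[X in _ + X]opprK (le_trans _ (lerB_dist _ _))// normrM normrN.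
rewrite lerBrDl (le_trans _ (ler_wpM2r _ (Mq x Mx)))//.
have -> : `|c| + d = d * (1 + `|c| / d) by field; rewrite gt_eqF.
by rewrite ler_wpM2l// ltW.
Qed.

(** Far out [|p|] is bounded below by [poly_lower_bound]; on the remaining compact interval it
    attains a nonzero minimum. *)
Lemma poly_inv_bounded p : (forall x, p.[x] != 0) ->
  exists C : R, forall x, `|p.[x]|^-1 <= C.
Proof.
move=> pn; have p0 : p != 0 by apply: contraNneq (pn 0) => ->; rewrite horner0.
have [M [c [c0 Mp]]] := poly_lower_bound p0.
have MM : - `|M| <= `|M| by rewrite (@le_trans _ _ 0)// oppr_le0.
have cp : {within `[- `|M|, `|M|], continuous (fun x => `|p.[x]|)}%classic.
  apply: continuous_subspaceT => x; apply: continuous_comp;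
    first exact: continuous_horner.
  exact: norm_continuous.
have [y _ py] := EVT_min MM cp.
exists (Num.max c^-1 `|p.[y]|^-1) => x; rewrite le_max.
have [Mx|xM] := leP `|M| `|x|; apply/orP.
  left; rewrite lef_pV2 ?posrE ?normr_gt0//.
  by apply: Mp; rewrite (le_trans (ler_norm M)).
right; rewrite lef_pV2 ?posrE ?normr_gt0//; apply: py.
by rewrite in_itv/= -ler_norml ltW.
Qed.

Lemma antiderivative p : exists q, q^`() = p.
Proof.
exists (\poly_(i < (size p).+1) (p`_i.-1 / i%:R)).
apply/polyP => i; rewrite coef_deriv coef_poly ltnS.
case: ltnP => ip; last by rewrite mul0rn nth_default.
by rewrite -[_ *+ _]mulr_natr divfK// pnatr_eq0.
Qed.

Lemma gauss_dominated_div2 p q : (forall x, q.[x] != 0) ->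
  gauss_dominated (fun x => p.[x] / q.[x] ^+ 2 * gauss_fun x).
Proof.
move=> q0; have [C qC] := poly_inv_bounded q0.
apply: (@gauss_dominated_poly R p (C ^+ 2)) => x.
rewrite !normrM (ger0_norm (gauss_fun_ge0 x)) ler_wpM2r ?gauss_fun_ge0// mulrC.
rewrite ler_wpM2r// normfV normrX -exprVn lerXn2r ?nnegrE//.
by rewrite (le_trans _ (qC x)).
Qed.

Lemma continuous_div2 p q : (forall x, q.[x] != 0) ->
  continuous (fun x => p.[x] / q.[x] ^+ 2 * gauss_fun x).
Proof.
move=> q0 x; apply: cvgM; last exact: continuous_gauss_fun.
apply: cvgM; first exact: continuous_horner.
apply: cvgV; first by rewrite expf_neq0.
have -> : (fun x => q.[x] ^+ 2) = horner (q ^+ 2).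
  by apply/funext => y; rewrite horner_exp.
rewrite -horner_exp; exact: continuous_horner.
Qed.

Lemma integrable_div2 p q : (forall x, q.[x] != 0) ->
  mu.-integrable setT (fun x => (p.[x] / q.[x] ^+ 2 * gauss_fun x)%:E).
Proof.
move=> q0; apply: integrable_gauss_dominated => //; last exact: gauss_dominated_div2.
by apply: continuous_measurable_fun; exact: continuous_div2.
Qed.

(** The integrand is the derivative of [p w / q], which tends to zero at both ends because [1 / q]
    is bounded. *)
Lemma Rintegral_deriv_div p q : (forall x, q.[x] != 0) ->
  (\int[mu]_x ((p^`() * q - p * q^`() - 2 *: 'X * p * q).[x] / q.[x] ^+ 2 *
    gauss_fun x) = 0)%R.
Proof.
move=> q0; apply: (gauss_FTCT (G := fun x => p.[x] / q.[x] * gauss_fun x)).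
- exact: continuous_div2.
- move=> x.
  have -> : (fun x => p.[x] / q.[x] * gauss_fun x) =
      (horner p * (fun x => gauss_fun x)) * (fun x => (q.[x])^-1).
    by apply/funext => y; rewrite /= mulrAC.
  have h := is_deriveM (is_derive_horner_gauss p x) (is_deriveV (q0 x)
    (is_derive_poly q x)).
  apply: (is_derive_eq h); rewrite !hornerE /= /GRing.scale/=.
  by field; exact: q0.
- exact: gauss_dominated_div2.
- have -> : (fun x => p.[x] / q.[x] * gauss_fun x) =
      (fun x => (p * q).[x] / q.[x] ^+ 2 * gauss_fun x).
    apply/funext => x; rewrite hornerM; congr (_ * _).
    by field; exact: q0.
  exact: gauss_dominated_div2.
Qed.

End NonvanishingPolynomial.

(** * Linearity and range of the bordered Wronskian *)

Section WronskianSpan.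
Variable R : realType.
Implicit Types (p q : {poly R}) (h : nat -> {poly R}).

(** The cofactors along the first row do not involve [p]; linearity in [p] follows. *)
Lemma wronskian_pcons_expand k h : exists cof : 'I_k.+1 -> {poly R},
  forall p, wronskian k.+1 (pcons p h) = \sum_(j < k.+1) p^`(j) * cof j.
Proof.
exists (fun j => cofactor (wronskian_mx k.+1 (pcons 0 h)) ord0 j) => p.
rewrite /wronskian (expand_det_row _ ord0); apply: eq_bigr => j _.
rewrite mxE /=; congr (_ * _); rewrite /cofactor; congr (_ * \det _).
by apply/matrixP => i m; rewrite !mxE.
Qed.

Lemma wronskian_pcons_sum k h n (a : nat -> R) (g : nat -> {poly R}) :
  wronskian k.+1 (pcons (\sum_(i < n) a i *: g i) h) =
  \sum_(i < n) a i *: wronskian k.+1 (pcons (g i) h).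
Proof.
have [cof cofE] := wronskian_pcons_expand k h; rewrite cofE.
under [RHS]eq_bigr do rewrite cofE scaler_sumr.
rewrite exchange_big; apply: eq_bigr => j _ /=.
rewrite raddf_sum mulr_suml; apply: eq_bigr => i _.
by rewrite /= derivnZ scalerAl.
Qed.

Lemma wronskian_pcons_mem k h i : (i < k)%N -> wronskian k.+1 (pcons (h i) h) = 0.
Proof.
move=> ik; apply: (determinant_alternate (i1 := ord0) (i2 :=
  lift ord0 (Ordinal ik))) => //.
by move=> j; rewrite !mxE.
Qed.

Lemma wronskian1 h p : wronskian 1 (pcons p h) = p.
Proof. by rewrite /wronskian det_mx11 mxE. Qed.

Lemma wronskian0 h : wronskian 0 h = 1.
Proof. by rewrite /wronskian det_mx00. Qed.

(* Variation of parameters: [p = \sum_i c_i h_i], where the [c_i] are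
   polynomials since [q] times the cofactors of the Wronskian matrix are. *)
Lemma wronskian_sqr_range k h q : exists p,
  wronskian k.+1 (pcons p h) = wronskian k h ^+ 2 * q.
Proof.
case: k => [|k]; first by exists q; rewrite wronskian1 wronskian0 expr1n mul1r.
pose C i := \adj (wronskian_mx k.+1 h) ord_max i.
(* The sign cancels the one produced by [wronskian_bordered]. *)
pose c i := sval (cid (antiderivative ((-1) ^+ k.+1 * C i * q))).
have cE i : (c i)^`() = (-1) ^+ k.+1 * C i * q by rewrite /c; case: cid.
pose p := \sum_i c i * h i; exists p.
(* Lagrange's condition: the terms in the derivatives of the [c i] cancel for [j < k], so the
   coefficients stay untouched up to the order [k]. *)
have D (j : nat) : (j < k.+1)%N -> (\sum_i c i * (h i)^`(j))^`() =
    (-1) ^+ k.+1 * q * (wronskian k.+1 h *+ (j == k)) + \sum_i c i * (h i)^`(j.+1).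
  move=> jk; rewrite raddf_sum /= -adj_lastE// mulr_sumr -big_split.
  by apply: eq_bigr => i _; rewrite derivM cE -derivnS /C; congr (_ + _); ring.
have pj (j : nat) : (j < k.+1)%N -> p^`(j) = \sum_i c i * (h i)^`(j).
  elim: j => [//|j IH] jk; rewrite derivnS IH ?(ltnW jk)// D ?(ltnW jk)//.
  by rewrite (_ : j == k = false) ?mulr0 ?add0r// ltn_eqF.
rewrite -[LHS]mul1r (@wronskian_bordered _ _ _ _ c _
  ((-1) ^+ k.+1 * q * wronskian k.+1 h)).
- by rewrite !mulrA -exprMn mulrNN mulr1 expr1n mul1r expr2; ring.
- by move=> j jk; rewrite mul1r pj.
- by rewrite mul1r derivnS pj// D// eqxx mulr1n addrC.
Qed.

End WronskianSpan.

(** * Exceptional Hermite polynomials *)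

Section Exceptional.
Variables (R : realType) (F : {fset nat}).
Hypothesis adm : admissible F.
Notation T := (measurableTypeR R).
Notation mu := (@lebesgue_measure R).
Local Notation s := (felems F).
Local Notation h := (fun i => hermite R (nth 0%N s i)).
Local Notation Om := (OmegaF R F).
Local Notation I := (gintegral [set: R]).

Lemma size_felems : size s = #|` F|.
Proof. by rewrite size_sort. Qed.

Lemma uniq_felems : uniq s.
Proof. by rewrite sort_uniq fset_uniq. Qed.

Lemma OmegaFE : Om = wronskian (size s) h.
Proof. by rewrite /OmegaF -size_felems. Qed.

Lemma hermiteFE n : hermiteF R F (uF F + n) = wronskian (size s).+1 (pcons
  (hermite R n) h).
Proof.
rewrite /hermiteF -size_felems addKn; congr (\det _).
by apply/matrixP => i j; rewrite !mxE; case: i => -[|i] ?.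
Qed.

Lemma sigmaFE n : sigmaF F (uF F + n) = (n \notin s).
Proof. by rewrite /sigmaF /= leq_addr /= mem_map//; exact: addnI. Qed.

Lemma sigmaFP n : sigmaF F n -> exists2 m, n = (uF F + m)%N & m \notin s.
Proof.
move=> nF; have un : (uF F <= n)%N by case/andP: nF.
exists (n - uF F)%N; first by rewrite subnKC.
by move: nF; rewrite -{1}(subnKC un) sigmaFE.
Qed.

Lemma even_size_felems : exists l, size s = l.*2.
Proof.
by have [es _] := admissible_symbol R adm; exists (size s)./2; rewrite even_halfK.
Qed.

Lemma OmegaF_neq0 x : Om.[x] != 0.
Proof.
have [l sl] := even_size_felems; rewrite OmegaFE.
exact: hermite_wronskian_neq0 sl uniq_felems (admissible_symbol R adm) x.
Qed.

Lemma omegaFE x : omegaF F x = gauss_fun x / Om.[x] ^+ 2.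
Proof. by []. Qed.

Lemma omegaF_gt0 (x : R) : 0 < omegaF F x.
Proof.
by rewrite divr_gt0 ?expR_gt0// lt_neqAle sqr_ge0 eq_sym sqrf_eq0 OmegaF_neq0.
Qed.

Lemma integrable_poly_omega p : mu.-integrable setT (fun x =>
  (p.[x] * omegaF F x)%:E).
Proof.
have := integrable_div2 p OmegaF_neq0; apply: eq_integrable => // x _.
by rewrite omegaFE mulrA mulrAC.
Qed.

Lemma integral_poly_omega p :
  (\int[omega_measure F]_x (p.[x])%:E)%E =
  (\int[mu]_x (p.[x] / Om.[x] ^+ 2 * gauss_fun x))%R%:E.
Proof.
rewrite integral_omega; last exact: measurable_horner.
rewrite -[LHS]fineK; last exact: (integrable_fin_num measurableT
  (integrable_poly_omega p)).
congr EFin; apply: eq_Rintegral => x _.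
by rewrite omegaFE mulrA mulrAC.
Qed.

(* The Darboux transformation [H_n -> H_n^F / Omega_F] multiplies inner
   products by [2 ^ k * \prod_(f in F) (n - f)]. *)
Lemma hermiteF_inner m n : n \notin s -> exists2 c : R, c != 0 &
  (\int[omega_measure F]_x
     ((hermiteF R F (uF F + m)).[x] * (hermiteF R F (uF F + n)).[x])%:E)%E =
  (c * I (hermite R m * hermite R n))%:E.
Proof.
move=> ns; rewrite !hermiteFE.
have [l sl] := even_size_felems.
under eq_integral do rewrite -hornerM.
rewrite integral_poly_omega.
(* Cramer's rule above needs at least one function. For empty [F] the polynomials are the Hermite
   polynomials themselves and the constant is [1]. *)
case: l sl => [|l] sl.
  exists 1; rewrite ?oner_eq0// mul1r; congr EFin; apply: eq_Rintegral => x _.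
  by rewrite OmegaFE sl wronskian0 !wronskian1 hornerC expr1n divr1.
have us := uniq_felems; have sym := admissible_symbol R adm.
pose c : R := 2 ^+ (size s) * \prod_(f <- s) (n%:R - f%:R).
exists c.
  rewrite mulf_neq0 ?expf_neq0 ?pnatr_eq0// prodf_seq_neq0; apply/allP => f fs.
  by rewrite /= subr_eq0 eqr_nat; apply: contraNneq ns => ->.
congr EFin.
have Om0 := Om_neq0 sl us sym.
have wrE p : wronskian (size s).+1 (pcons p h) = residual l.*2.+1 h p.
  rewrite sl; have := wronskian_residual Om0 p.
  by rewrite -doubleS -signr_odd odd_double expr0 mul1r.
have OE : Om = wronskian l.*2.+2 h by rewrite OmegaFE sl.
pose B := \sum_(i < l.*2.+2) cramer h (hermite R m) i * halfline_poly R s n i.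
(* Pointwise, up to the factor [c], the integrand is an exact derivative, of zero integral, plus the
   Hermite integrand. *)
have key x : (wronskian (size s).+1 (pcons (hermite R m) h) *
     wronskian (size s).+1 (pcons (hermite R n) h)).[x] / Om.[x] ^+ 2 * gauss_fun x =
   c * ((B^`() * Om - B * Om^`() - 2 *: 'X * B * Om).[x] / Om.[x] ^+ 2 * gauss_fun x +
        (hermite R m * hermite R n).[x] * gauss_fun x).
  have := cramer_halfline sl us sym m x ns; rewrite -OE -/B /= => e.
  rewrite !wrE hornerM e /c sl -doubleS (hornerM (Om ^+ 2)) horner_exp.
  move: (_ * \prod_(_ <- _) _) (_ - _).[x] (_ * _).[x] => a b d.
  by field; exact: OmegaF_neq0.
under eq_Rintegral do rewrite key.
have i1 := integrable_div2 (B^`() * Om - B * Om^`() - 2 *: 'X * B * Om) OmegaF_neq0.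
have i2 := integrable_horner_gauss (hermite R m * hermite R n) measurableT.
rewrite RintegralZl//; last exact: (integrableD measurableT i1 i2).
rewrite RintegralD//.
by rewrite Rintegral_deriv_div ?add0r//; exact: OmegaF_neq0.
Qed.

(** [wronskian_sqr_range] presents the left side as a Wronskian bordered by some [p]. Expanding [p]
    in Hermite polynomials gives the [hermiteF]; terms with index in [felems F] have a repeated row
    and drop out. *)
Lemma hermiteF_span q : exists (t : seq nat) (c : nat -> R), all (sigmaF F) t /\
  Om ^+ 2 * q = \sum_(n <- t) c n *: hermiteF R F n.
Proof.
have [p pE] := wronskian_sqr_range (size s) h q.
have [a aE] := hermite_span p.
exists [seq (uF F + n)%N | n <- iota 0 (size p) & n \notin s], (fun n =>
  a (n - uF F)%N).
split.
  by apply/allP => x /mapP[n]; rewrite mem_filter => /andP[ns _] ->; rewrite sigmaFE.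
rewrite OmegaFE -pE {1}aE wronskian_pcons_sum big_map big_filter.
rewrite -(big_mkord xpredT (fun n => a n *: wronskian (size s).+1 (pcons
  (hermite R n) h))).
rewrite /index_iota subn0 (bigID (fun n => n \notin s))/= [X in _ + X]big1 ?addr0.
  by apply: eq_bigr => n _; rewrite hermiteFE addKn.
move=> n; rewrite negbK => ns.
have ins : (index n s < size s)%N by rewrite index_mem.
by have := wronskian_pcons_mem h ins; rewrite nth_index// => ->; rewrite scaler0.
Qed.

Lemma Lfun2_of_integrable_sqr (f : T -> R) : measurable_fun [set: T]%classic f ->
  (omega_measure F).-integrable setT (fun x => (f x ^+ 2)%:E) ->
  f \in Lfun (omega_measure F) 2%:E.
Proof.
move=> mf /integrableP[_ fo]; rewrite inE; apply/andP; split; rewrite inE//=.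
rewrite /finite_norm unlock poweR_lty//; apply: le_lt_trans fo.
rewrite le_eqVlt; apply/orP; left; apply/eqP; apply: eq_integral => x _ /=.
by rewrite powR_mulrn// real_normK ?num_real// ger0_norm ?sqr_ge0.
Qed.

Lemma hermiteF_Lfun n : horner (hermiteF R F n) \in Lfun (omega_measure F) 2%:E.
Proof.
apply: Lfun2_of_integrable_sqr; first exact: measurable_horner.
apply: integrable_omega; first by apply: measurable_funX; exact: measurable_horner.
have := integrable_poly_omega (hermiteF R F n ^+ 2).
by apply: eq_integrable => // x _; rewrite horner_exp.
Qed.

Lemma hermiteF_orthogonal :
  orthogonal_wrt (@omega_measure R F) (sigmaF F) (@hermiteF R F).
Proof.
split=> [n _|n m|n].
- exact: hermiteF_Lfun.
- move=> /sigmaFP[n' -> _] /sigmaFP[m' -> ms] nm.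
  have [c _ ->] := hermiteF_inner n' ms.
  rewrite hermite_orthogonal ?mulr0//.
  by apply/eqP => e; apply: nm; rewrite e.
- move=> /sigmaFP[n' -> ns]; under eq_integral do rewrite expr2.
  have [c c0 ->] := hermiteF_inner n' ns.
  by rewrite eqe mulf_neq0// gt_eqF// hermite_norm_gt0.
Qed.

(** The density theorem with [r = Om ^+ 2], whose polynomial multiples lie in the span by
    [hermiteF_span]. *)
Lemma hermiteF_complete :
  complete_wrt (@omega_measure R F) (sigmaF F) (@hermiteF R F).
Proof.
move=> f fL e e0.
have mf : measurable_fun [set: T]%classic f by move: fL;
  rewrite inE => /andP[/[!inE]].
have f2 := Lfun2_integrable_sqr fL.
(* One factor [Om ^+ 2] cancels the denominator of the weight, leaving a polynomial times an
   exponential times the Gaussian. *)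
have rexp (M : R) : (omega_measure F).-integrable setT
    (fun x : T => ((Om ^+ 2).[x] ^+ 2 * expR (M * `|x|))%:E).
  have mr : measurable_fun [set: T]%classic (fun x : T =>
    (Om ^+ 2).[x] ^+ 2 * expR (M * `|x|)).
    apply: measurable_funM; first by apply: measurable_funX; exact: measurable_horner.
    by apply: measurableT_comp => //; apply: measurable_funM.
  apply: integrable_omega => //; apply: integrable_gauss_dominated => //.
    by apply: measurable_funM => //; exact: measurable_omegaF.
  have [C C0 OC] := poly_le_expR (Om ^+ 2).
  exists C, (1 + M) => x; rewrite omegaFE.
  have -> : (Om ^+ 2).[x] ^+ 2 * expR (M * `|x|) * (gauss_fun x / Om.[x] ^+ 2) =
      (Om ^+ 2).[x] * expR (M * `|x|) * gauss_fun x.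
    by rewrite horner_exp; field; exact: OmegaF_neq0.
  rewrite !normrM (ger0_norm (gauss_fun_ge0 x)) (ger0_norm (expR_ge0 _)).
  rewrite ler_wpM2r ?gauss_fun_ge0// mulrDl mul1r expRD mulrA.
  by rewrite ler_wpM2r ?expR_ge0.
have r0 x : (Om ^+ 2).[x] != 0 by rewrite horner_exp expf_neq0// OmegaF_neq0.
(* [approximable] measures squared distances, hence [e ^+ 2]. *)
have [_ /(_ (e ^+ 2))[|q qe]] := poly_multiple_dense rexp r0 mf f2.
  by rewrite exprn_gt0.
have [t [c [ts tE]]] := hermiteF_span q; exists t, c; split=> //.
rewrite -tE unlock.
set i := (\int[_]_x _)%E.
have iE : i = (\int[omega_measure F]_x ((f x - (Om ^+ 2).[x] * q.[x]) ^+ 2)%:E)%E.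
  apply: eq_integral => x _ /=.
  by rewrite powR_mulrn// real_normK ?num_real// hornerM.
have i0 : (0 <= i)%E by apply: integral_ge0 => x _; exact: poweR_ge0.
rewrite -iE in qe.
have ifin : i \is a fin_num by rewrite ge0_fin_numE// (lt_trans qe)// ltry.
rewrite -(fineK ifin) poweR_EFin lte_fin powR12_sqrt ?fine_ge0//.
rewrite -(ger0_norm (ltW e0)) -sqrtr_sqr ltr_sqrt ?exprn_gt0//.
by rewrite -lte_fin fineK.
Qed.

End Exceptional.

Theorem theorem6p4 (R : realType) (F : {fset nat})
    (hpos : forall f : nat, f \in F -> (0 < f)%N)
    (hadm : admissible F) :
  [/\ forall x : R, 0 < omegaF F x,
      orthogonal_wrt (@omega_measure R F) (sigmaF F) (@hermiteF R F),
      complete_wrt (@omega_measure R F) (sigmaF F) (@hermiteF R F)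
    & orthogonal_complete (sigmaF F) (@hermiteF R F)].
Proof.
have o := @hermiteF_orthogonal R F hadm; have c := @hermiteF_complete R F hadm.
split=> //; first by move=> x; exact: omegaF_gt0.
by exists (@omega_measure R F).
Qed.
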